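(* Let $(\mathbf V,\otimes,\mathbf 1)$ be a monoidal category with pullbacks and let $\mathcal B$ be a $\mathbf V$-category with underlying category $\mathcal B_0$. The inverse Grothendieck construction, which sends an opfibration $p:\mathcal E\to\mathcal B$ to the pseudofunctor $\mathcal E_\bullet:\mathcal B_0\to\mathbf V\text{-}\mathsf{Cat}$ (defined in the context), extends to a $2$-functor $$I:\mathsf{opFib}(\mathcal B)\to\mathsf{Fun}^{\mathsf{ps}}(\mathcal B_0,\mathbf V\text{-}\mathsf{Cat}).$$
   Context: **Enriched conventions.** $\mathbf V$ is locally small; $\mathbf V\text{-}\mathsf{Cat}$ is the strict $2$-category of small $\mathbf V$-categories, $\mathbf V$-functors and $\mathbf V$-natural transformations. A map $f:\mathbf 1\to\mathcal C(b,c)$ is a morphism $b\to c$ in the underlying category $\mathcal C_0$; it induces $-\circ f:\mathcal C(c,d)\to\mathcal C(b,d)$ and $f\circ-:\mathcal C(a,b)\to\mathcal C(a,c)$, and is an isomorphism if these are isomorphisms in $\mathbf V$ for all $a,d$. For a $\mathbf V$-functor $p$, $pf$ denotes $f$ followed by the hom-map of $p$; $f$ lies over $pf$, and an object $e$ lies over $pe$. **Opfibrations.** A map $\chi:\mathbf 1\to\mathcal E(e,e')$ is $p$-opcartesian, for $p:\mathcal E\to\mathcal B$, if for all $d\in\mathcal E$ the square with top $-\circ\chi:\mathcal E(e',d)\to\mathcal E(e,d)$, bottom $-\circ p\chi:\mathcal B(pe',pd)\to\mathcal B(pe,pd)$ and vertical maps given by $p$ is a pullback in $\mathbf V$. An opfibration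 is a $\mathbf V$-functor $p:\mathcal E\to\mathcal B$ along with, for every $e\in\mathcal E$, $b\in\mathcal B$, $f:\mathbf 1\to\mathcal B(pe,b)$, a chosen object $f_!e$ over $b$ and a chosen $p$-opcartesian map $\chi(f,e):\mathbf 1\to\mathcal E(e,f_!e)$ over $f$. An opfibered functor from $p:\mathcal E\to\mathcal B$ to $q:\mathcal F\to\mathcal B$ is a $\mathbf V$-functor $k$ with $qk=p$ sending $p$-opcartesian maps to $q$-opcartesian maps. $\mathsf{opFib}(\mathcal B)$ is the $2$-category of opfibrations over $\mathcal B$, opfibered functors, and $\mathbf V$-natural transformations over $\mathcal B$ (components lying over identities). For a $p$-opcartesian map $\chi:\mathbf 1\to\mathcal E(e,e')$, $\varepsilon_\chi:\mathbf 1\to\mathcal E((p\chi)_!e,e')$ denotes the unique isomorphism lying over $1_{pe'}$ with $\varepsilon_\chi\circ\chi(p\chi,e)=\chi$. **The pseudofunctor $\mathcal E_\bullet$.** The fiber $\mathcal E_b$ of $p$ over $b$ has objects those $e\in\mathcal E$ with $pe=b$, and $\mathcal E_b(e,e')$ is the pullback of $p:\mathcal E(e,e')\to\mathcal B(b,b)$ along $1_b:\mathbf 1\to\mathcal B(b,b)$; maps of $\mathcal E$ lying over $1_b$ are regarded as maps of $\mathcal E_b$. For $f\in\mathcal B_0(b,b')$, the transport $f_!:\mathcal E_b\to\mathcal E_{b'}$ is $e\mapsto f_!e$ on objects, and on homs $\mathcal E_b(e,e')\to\mathcal E_{b'}(f_!e,f_!e')$ is the unique $\mathbf V$-morphism compatible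 with the projections to $\mathbf 1$ such that following it by $\mathcal E_{b'}(f_!e,f_!e')\to\mathcal E(f_!e,f_!e')\xrightarrow{-\circ\chi(f,e)}\mathcal E(e,f_!e')$ gives $\mathcal E_b(e,e')\to\mathcal E(e,e')\xrightarrow{\chi(f,e')\circ-}\mathcal E(e,f_!e')$. $\mathcal E_\bullet$ sends $b\mapsto\mathcal E_b$ and $f\mapsto f_!$, with structure isomorphisms $\xi_e=\varepsilon_{1_e}:(1_b)_!e\cong e$ and $\theta(f,g)_e=\varepsilon_{\chi(g,f_!e)\chi(f,e)}:(gf)_!e\cong g_!f_!e$. **Pseudofunctors.** A pseudofunctor $F:B\to\mathbf V\text{-}\mathsf{Cat}$ ($B$ an ordinary category) consists of $\mathbf V$-categories $F_b$, $\mathbf V$-functors $F_f:F_b\to F_c$ ($f:b\to c$), natural isomorphisms $\xi(b):F_{1_b}\cong1_{F_b}$ and $\theta(f,g):F_{gf}\cong F_gF_f$ with $(F_f\xi(b))\cdot\theta(1_b,f)=1_{F_f}$, $(\xi(c)F_f)\cdot\theta(f,1_c)=1_{F_f}$, $(F_h\theta(f,g))\cdot\theta(gf,h)=(\theta(g,h)F_f)\cdot\theta(f,hg)$. A pseudonatural transformation $\alpha:F\Rightarrow G$ consists of $\mathbf V$-functors $\alpha_b:F_b\to G_b$ and natural isomorphisms $\alpha_f:G_f\alpha_b\cong\alpha_cF_f$ satisfying $(\alpha_d\theta^F)\cdot\alpha_{gf}=(\alpha_gF_f)\cdot(G_g\alpha_f)\cdot(\theta^G\alpha_b)$ and $(\alpha_b\xi^F)\cdot\alpha_{1_b}=\xi^G\alpha_b$.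 A modification $\Gamma:\alpha\Rrightarrow\beta$ consists of natural transformations $\Gamma_b:\alpha_b\Rightarrow\beta_b$ with $(\Gamma_cF_f)\cdot\alpha_f=\beta_f\cdot(G_f\Gamma_b)$. These form the $2$-category $\mathsf{Fun}^{\mathsf{ps}}(B,\mathbf V\text{-}\mathsf{Cat})$. *)

(* Defs.v *)
From Stdlib Require Import ssreflect ssrfun.
From Stdlib Require Import FunctionalExtensionality ProofIrrelevance ClassicalEpsilon.

Set Implicit Arguments.
Unset Strict Implicit.
Unset Printing Implicit Defensive.

Record Category := {
  Ob :> Type;
  Hom : Ob -> Ob -> Type;
  idm : forall a, Hom a a;
  comp : forall a b c, Hom b c -> Hom a b -> Hom a c;
  comp_assoc : forall a b c d (h : Hom c d) (g : Hom b c) (f : Hom a b),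
    comp h (comp g f) = comp (comp h g) f;
  comp_idl : forall a b (f : Hom a b), comp (idm b) f = f;
  comp_idr : forall a b (f : Hom a b), comp f (idm a) = f }.

Arguments Hom {_} _ _.
Arguments idm {_} _.
Arguments comp {_ _ _ _} _ _.

Notation "g ∘ f" := (comp g f) (at level 40, left associativity).

Definition is_iso {C : Category} {a b : C} (f : Hom a b) : Prop :=
  exists g : Hom b a, g ∘ f = idm a /\ f ∘ g = idm b.

Record is_pullback {C : Category} {P A B D : C}
    (p1 : Hom P A) (p2 : Hom P B) (f : Hom A D) (g : Hom B D) : Prop := {
  pb_comm : f ∘ p1 = g ∘ p2;
  pb_univ : forall Q (q1 : Hom Q A) (q2 : Hom Q B), f ∘ q1 = g ∘ q2 ->
    exists! u : Hom Q P, p1 ∘ u = q1 /\ p2 ∘ u = q2 }.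

Record Pullback {C : Category} {A B D : C} (f : Hom A D) (g : Hom B D) := {
  apex : C;
  pr1 : Hom apex A;
  pr2 : Hom apex B;
  pullbackP : is_pullback pr1 pr2 f g }.

Definition Pullbacks (C : Category) : Type :=
  forall (A B D : C) (f : Hom A D) (g : Hom B D), Pullback f g.

Record MonoidalCategory := {
  mcat :> Category;
  tens : mcat -> mcat -> mcat;
  tensm : forall a a' b b' : mcat,
    Hom a a' -> Hom b b' -> Hom (tens a b) (tens a' b');
  munit : mcat;
  assoc : forall a b c, Hom (tens (tens a b) c) (tens a (tens b c));
  assocV : forall a b c, Hom (tens a (tens b c)) (tens (tens a b) c);
  lunit : forall a, Hom (tens munit a) a;
  lunitV : forall a, Hom a (tens munit a);
  runit : forall a, Hom (tens a munit) a;
  runitV : forall a, Hom a (tens a munit);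
  tens_id : forall a b, tensm (idm a) (idm b) = idm (tens a b);
  tens_comp : forall a a' a'' b b' b'' (f' : Hom a' a'') (f : Hom a a')
      (g' : Hom b' b'') (g : Hom b b'),
    tensm (f' ∘ f) (g' ∘ g) = tensm f' g' ∘ tensm f g;
  assocK : forall a b c, assocV a b c ∘ assoc a b c = idm _;
  assocVK : forall a b c, assoc a b c ∘ assocV a b c = idm _;
  lunitK : forall a, lunitV a ∘ lunit a = idm _;
  lunitVK : forall a, lunit a ∘ lunitV a = idm _;
  runitK : forall a, runitV a ∘ runit a = idm _;
  runitVK : forall a, runit a ∘ runitV a = idm _;
  assoc_nat : forall a a' b b' c c' (f : Hom a a') (g : Hom b b') (h : Hom c c'),
    assoc a' b' c' ∘ tensm (tensm f g) h = tensm f (tensm g h) ∘ assoc a b c;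
  lunit_nat : forall a a' (f : Hom a a'),
    lunit a' ∘ tensm (idm munit) f = f ∘ lunit a;
  runit_nat : forall a a' (f : Hom a a'),
    runit a' ∘ tensm f (idm munit) = f ∘ runit a;
  triangle : forall a b,
    tensm (idm a) (lunit b) ∘ assoc a munit b = tensm (runit a) (idm b);
  pentagon : forall a b c d,
    tensm (idm a) (assoc b c d) ∘ assoc a (tens b c) d ∘ tensm (assoc a b c) (idm d)
    = assoc a b (tens c d) ∘ assoc (tens a b) c d }.

Arguments tensm {_ _ _ _ _} _ _.
Arguments munit {_}.
Arguments assoc {_} _ _ _.
Arguments assocV {m} _ _ _.
Arguments lunit {_} _.
Arguments lunitV {m} _.
Arguments runit {_} _.
Arguments runitV {m} _.

Notation "a ⊗ b" := (tens a b) (at level 35, right associativity).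
Notation "f ⊠ g" := (tensm f g) (at level 35, right associativity).
Notation "𝟙" := munit.

Lemma comp_l {C : Category} {a b c : C} (h : Hom b c) (f g : Hom a b) :
  f = g -> h ∘ f = h ∘ g.
Proof. by move=> ->. Qed.

Lemma comp_r {C : Category} {a b c : C} (h : Hom a b) (f g : Hom b c) :
  f = g -> f ∘ h = g ∘ h.
Proof. by move=> ->. Qed.

Lemma pb_ext {C : Category} {P A B D : C} (p1 : Hom P A) (p2 : Hom P B)
    (f : Hom A D) (g : Hom B D) (H : is_pullback p1 p2 f g) Q (u v : Hom Q P) :
  p1 ∘ u = p1 ∘ v -> p2 ∘ u = p2 ∘ v -> u = v.
Proof.
move=> e1 e2.
have [|w [_ uw]] := @pb_univ _ _ _ _ _ _ _ _ _ H Q (p1 ∘ u) (p2 ∘ u).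
  by rewrite !comp_assoc (pb_comm H).
by rewrite -(uw u) // -(uw v).
Qed.

Definition pb_lift {C : Category} {P A B D : C} (p1 : Hom P A) (p2 : Hom P B)
    (f : Hom A D) (g : Hom B D) (H : is_pullback p1 p2 f g) Q
    (q1 : Hom Q A) (q2 : Hom Q B) (e : f ∘ q1 = g ∘ q2) : Hom Q P :=
  proj1_sig (constructive_indefinite_description _ (pb_univ H e)).

Section PbLift.
Context {C : Category} {P A B D : C} (p1 : Hom P A) (p2 : Hom P B)
    (f : Hom A D) (g : Hom B D) (H : is_pullback p1 p2 f g) (Q : C)
    (q1 : Hom Q A) (q2 : Hom Q B) (e : f ∘ q1 = g ∘ q2).

Lemma pb_lift1 : p1 ∘ pb_lift H e = q1.
Proof. by rewrite /pb_lift; case: constructive_indefinite_description => u [[]]. Qed.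

Lemma pb_lift2 : p2 ∘ pb_lift H e = q2.
Proof. by rewrite /pb_lift; case: constructive_indefinite_description => u [[]]. Qed.
End PbLift.

Section Monoidal.
Context {V : MonoidalCategory}.
Implicit Types a b c : V.

Lemma lunit_faith a b (f g : Hom a b) : idm 𝟙 ⊠ f = idm 𝟙 ⊠ g -> f = g.
Proof.
move=> e.
by rewrite -[f]comp_idr -[g]comp_idr -(lunitVK a) !comp_assoc -!lunit_nat e.
Qed.

Lemma runit_faith a b (f g : Hom a b) : f ⊠ idm 𝟙 = g ⊠ idm 𝟙 -> f = g.
Proof.
move=> e.
by rewrite -[f]comp_idr -[g]comp_idr -(runitVK a) !comp_assoc -!runit_nat e.
Qed.

Lemma tens_compl a a' a'' b (f' : Hom a' a'') (f : Hom a a') :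
  (f' ∘ f) ⊠ idm b = (f' ⊠ idm b) ∘ (f ⊠ idm b).
Proof. by rewrite -tens_comp comp_idl. Qed.

Lemma tens_compr a a' a'' b (f' : Hom a' a'') (f : Hom a a') :
  idm b ⊠ (f' ∘ f) = (idm b ⊠ f') ∘ (idm b ⊠ f).
Proof. by rewrite -tens_comp comp_idl. Qed.

Lemma tens_splitl a b c d e (f : Hom b c) (g : Hom a b) (h : Hom d e) :
  (f ∘ g) ⊠ h = (f ⊠ idm e) ∘ (g ⊠ h).
Proof. by rewrite -tens_comp comp_idl. Qed.

Lemma tens_splitr a b c d e (f : Hom b c) (g : Hom a b) (h : Hom d e) :
  h ⊠ (f ∘ g) = (idm e ⊠ f) ∘ (h ⊠ g).
Proof. by rewrite -tens_comp comp_idl. Qed.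

Lemma assoc_epi a b c d (f g : Hom (a ⊗ b ⊗ c) d) :
  f ∘ assoc a b c = g ∘ assoc a b c -> f = g.
Proof.
move=> e.
by rewrite -[f]comp_idr -[g]comp_idr -(assocVK a b c) !comp_assoc e.
Qed.

Lemma assoc_mono a b c d (f g : Hom d ((a ⊗ b) ⊗ c)) :
  assoc a b c ∘ f = assoc a b c ∘ g -> f = g.
Proof.
move=> e.
by rewrite -[f]comp_idl -[g]comp_idl -(assocK a b c) -!comp_assoc e.
Qed.

Lemma assocl_epi a b c d e (f g : Hom ((a ⊗ b ⊗ c) ⊗ d) e) :
  f ∘ (assoc a b c ⊠ idm d) = g ∘ (assoc a b c ⊠ idm d) -> f = g.
Proof.
move=> E.
by rewrite -[f]comp_idr -[g]comp_idr -tens_id -(assocVK a b c) tens_compl !comp_assoc E.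
Qed.

Lemma lunit_tens a b : lunit (a ⊗ b) ∘ assoc 𝟙 a b = lunit a ⊠ idm b.
Proof.
apply: lunit_faith; apply: assoc_epi; apply: assocl_epi.
have P := pentagon 𝟙 𝟙 a b; rewrite -comp_assoc in P.
rewrite tens_compr -!comp_assoc P comp_assoc triangle.
rewrite (comp_assoc (idm 𝟙 ⊠ _)) -assoc_nat -comp_assoc.
by rewrite -tens_compl triangle assoc_nat tens_id.
Qed.

Lemma lunit_lunit a : lunit (𝟙 ⊗ a) = idm 𝟙 ⊠ lunit a.
Proof.
have e := lunit_nat (lunit a).
by rewrite -[LHS]comp_idl -[RHS]comp_idl -lunitK -!comp_assoc e.
Qed.

Lemma lunit_runit : lunit (𝟙 : V) = runit 𝟙.
Proof.
apply: runit_faith.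
by rewrite -lunit_tens lunit_lunit triangle.
Qed.

Lemma runit_tens a b : (idm a ⊠ runit b) ∘ assoc a b 𝟙 = runit (a ⊗ b).
Proof.
apply: runit_faith; apply: assoc_mono.
have P := pentagon a b 𝟙 𝟙; rewrite -comp_assoc in P.
rewrite tens_compl comp_assoc assoc_nat -triangle tens_compr.
rewrite -!comp_assoc P comp_assoc.
by rewrite -assoc_nat -comp_assoc tens_id triangle.
Qed.

Lemma lunitV_nat a a' (f : Hom a a') : lunitV a' ∘ f = (idm 𝟙 ⊠ f) ∘ lunitV a.
Proof.
by rewrite -[RHS]comp_idl -lunitK -!comp_assoc (comp_assoc (lunit _)) lunit_nat
  -comp_assoc lunitVK comp_idr.
Qed.

Lemma runitV_nat a a' (f : Hom a a') : runitV a' ∘ f = (f ⊠ idm 𝟙) ∘ runitV a.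
Proof.
by rewrite -[RHS]comp_idl -runitK -!comp_assoc (comp_assoc (runit _)) runit_nat
  -comp_assoc runitVK comp_idr.
Qed.

Lemma triangleV a b :
  assoc a 𝟙 b ∘ (runitV a ⊠ idm b) = idm a ⊠ lunitV b.
Proof.
rewrite -[LHS]comp_idl -tens_id -(lunitK b) tens_compr -comp_assoc.
by rewrite (comp_assoc _ (assoc _ _ _)) triangle -tens_compl runitVK tens_id comp_idr.
Qed.

Lemma lunitV_tens a b : assoc 𝟙 a b ∘ (lunitV a ⊠ idm b) = lunitV (a ⊗ b).
Proof.
rewrite -[LHS]comp_idl -(lunitK (a ⊗ b)) -!comp_assoc.
by rewrite (comp_assoc _ (assoc _ _ _)) lunit_tens -tens_compl lunitVK tens_id comp_idr.
Qed.

Lemma runitV_tens a b : assoc a b 𝟙 ∘ runitV (a ⊗ b) = idm a ⊠ runitV b.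
Proof.
rewrite -[LHS]comp_idl -tens_id -(runitK b) tens_compr -!comp_assoc.
by rewrite (comp_assoc _ (assoc _ _ _)) runit_tens runitVK comp_idr.
Qed.

Lemma lunitV_runitV : lunitV (𝟙 : V) = runitV 𝟙.
Proof.
by rewrite -[LHS]comp_idr -(runitVK 𝟙) -lunit_runit comp_assoc lunitK comp_idl.
Qed.

End Monoidal.

Record VCategory (V : MonoidalCategory) := {
  vob :> Type;
  vhom : vob -> vob -> V;
  vid : forall a, Hom 𝟙 (vhom a a);
  vcomp : forall a b c, Hom (vhom b c ⊗ vhom a b) (vhom a c);
  vcomp_assoc : forall a b c d,
    vcomp a b d ∘ (vcomp b c d ⊠ idm (vhom a b))
    = vcomp a c d ∘ (idm (vhom c d) ⊠ vcomp a b c) ∘ assoc _ _ _;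
  vcomp_idl : forall a b, vcomp a b b ∘ (vid b ⊠ idm (vhom a b)) = lunit _;
  vcomp_idr : forall a b, vcomp a a b ∘ (idm (vhom a b) ⊠ vid a) = runit _ }.

Arguments vhom {V _} _ _.
Arguments vid {V _} _.
Arguments vcomp {V _} _ _ _.

Section Enriched.
Context {V : MonoidalCategory}.
Implicit Types C D : VCategory V.

Definition umap C (a b : C) : Type := Hom 𝟙 (vhom a b).

Definition precomp C (a b d : C) (f : umap a b) : Hom (vhom b d) (vhom a d) :=
  vcomp a b d ∘ (idm _ ⊠ f) ∘ runitV _.

Definition postcomp C (a b c : C) (f : umap b c) : Hom (vhom a b) (vhom a c) :=
  vcomp a b c ∘ (f ⊠ idm _) ∘ lunitV _.

Definition ucomp C (a b c : C) (g : umap b c) (f : umap a b) : umap a c :=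
  vcomp a b c ∘ (g ⊠ f) ∘ lunitV 𝟙.

(** Invertibility of [f] in the underlying category is equivalent, see [visoP]. *)
Definition is_viso C (a b : C) (f : umap a b) : Prop :=
  (forall d, is_iso (precomp d f)) /\ (forall c, is_iso (postcomp c f)).

End Enriched.

Notation "g ⊚ f" := (ucomp g f) (at level 40, left associativity).

Section Enriched2.
Context {V : MonoidalCategory}.
Implicit Types C D : VCategory V.

Lemma precomp_app C (a b d : C) (f : umap a b) (g : umap b d) :
  precomp d f ∘ g = g ⊚ f.
Proof.
rewrite /precomp /ucomp -!comp_assoc runitV_nat lunitV_runitV; congr (_ ∘ _).
by rewrite comp_assoc -tens_comp comp_idl comp_idr.
Qed.

Lemma postcomp_app C (a b d : C) (f : umap a b) (g : umap b d) :
  postcomp a g ∘ f = g ⊚ f.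
Proof.
rewrite /postcomp /ucomp -!comp_assoc lunitV_nat; congr (_ ∘ _).
by rewrite comp_assoc -tens_comp comp_idl comp_idr.
Qed.

Lemma precomp_id C (a d : C) : precomp d (vid a) = idm _.
Proof. by rewrite /precomp vcomp_idr runitVK. Qed.

Lemma postcomp_id C (a d : C) : postcomp a (vid d) = idm _.
Proof. by rewrite /postcomp vcomp_idl lunitVK. Qed.

Lemma vcomp_postcomp C (a b c d : C) (f : umap c d) :
  vcomp a b d ∘ (postcomp b f ⊠ idm _) = postcomp a f ∘ vcomp a b c.
Proof.
rewrite /postcomp !tens_compl -!comp_assoc.
rewrite lunitV_nat (comp_assoc (vcomp _ _ _)) vcomp_assoc -!comp_assoc.
congr (_ ∘ _).
rewrite (comp_assoc (assoc _ _ _)) assoc_nat -!comp_assoc lunitV_tens.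
rewrite tens_id (comp_assoc (f ⊠ _)) (comp_assoc (idm _ ⊠ _)) -!tens_comp.
by rewrite !comp_idl !comp_idr.
Qed.

Lemma vcomp_precomp C (a b c d : C) (f : umap a b) :
  vcomp a c d ∘ (idm _ ⊠ precomp c f) = precomp d f ∘ vcomp b c d.
Proof.
have E : (idm (vhom b d) ⊠ f) ∘ (vcomp b c d ⊠ idm 𝟙)
    = (vcomp b c d ⊠ idm _) ∘ (idm _ ⊠ f).
  by rewrite -!tens_comp !comp_idl !comp_idr.
rewrite /precomp !tens_compr -!comp_assoc runitV_nat (comp_assoc (idm _ ⊠ f)) E.
rewrite -!comp_assoc (comp_assoc (vcomp a b d)) vcomp_assoc -!comp_assoc.
congr (_ ∘ (_ ∘ _)).
by rewrite -tens_id (comp_assoc (assoc _ _ _)) assoc_nat -!comp_assoc runitV_tens.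
Qed.

Lemma vcomp_prepost C (a b c d : C) (f : umap b c) :
  vcomp a b d ∘ (precomp d f ⊠ idm _) = vcomp a c d ∘ (idm _ ⊠ postcomp a f).
Proof.
rewrite /precomp /postcomp !tens_compr !tens_compl.
rewrite !comp_assoc vcomp_assoc -!comp_assoc; congr (_ ∘ (_ ∘ _)).
by rewrite comp_assoc assoc_nat -comp_assoc triangleV.
Qed.

Lemma postcomp_comp C (a b c d : C) (g : umap c d) (f : umap b c) :
  postcomp a (g ⊚ f) = postcomp a g ∘ postcomp a f.
Proof.
rewrite -postcomp_app {1}/postcomp tens_compl !comp_assoc vcomp_postcomp.
by rewrite /postcomp -!comp_assoc.
Qed.

Lemma precomp_comp C (a b c d : C) (g : umap b c) (f : umap a b) :
  precomp d (g ⊚ f) = precomp d f ∘ precomp d g.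
Proof.
rewrite -precomp_app {1}/precomp tens_compr !comp_assoc vcomp_precomp.
by rewrite /precomp -!comp_assoc.
Qed.

Lemma pre_postcomp C (a b c d : C) (g : umap c d) (f : umap a b) :
  precomp d f ∘ postcomp b g = postcomp a g ∘ precomp c f.
Proof.
rewrite /postcomp -!comp_assoc lunitV_nat !comp_assoc.
rewrite -vcomp_precomp -!comp_assoc; congr (_ ∘ _).
by rewrite !comp_assoc -!tens_comp !comp_idl !comp_idr.
Qed.

Lemma ucompA C (a b c d : C) (h : umap c d) (g : umap b c) (f : umap a b) :
  h ⊚ (g ⊚ f) = h ⊚ g ⊚ f.
Proof.
by rewrite -(postcomp_app (g ⊚ f)) -!(postcomp_app f) comp_assoc postcomp_comp.
Qed.

Lemma ucomp_idl C (a b : C) (f : umap a b) : vid b ⊚ f = f.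
Proof. by rewrite -postcomp_app postcomp_id comp_idl. Qed.

Lemma ucomp_idr C (a b : C) (f : umap a b) : f ⊚ vid a = f.
Proof. by rewrite -precomp_app precomp_id comp_idl. Qed.

Lemma precompE C (a b d : C) (f : umap a b) :
  precomp d f = vcomp a b d ∘ (idm _ ⊠ f) ∘ runitV _.
Proof. by []. Qed.

Lemma postcompE C (a b c : C) (f : umap b c) :
  postcomp a f = vcomp a b c ∘ (f ⊠ idm _) ∘ lunitV _.
Proof. by []. Qed.

Lemma ucompE C (a b c : C) (g : umap b c) (f : umap a b) :
  g ⊚ f = vcomp a b c ∘ (g ⊠ f) ∘ lunitV 𝟙.
Proof. by []. Qed.

End Enriched2.

Global Opaque precomp postcomp ucomp.

Definition underlying (V : MonoidalCategory) (C : VCategory V) : Category := {|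
  Ob := C;
  Hom := fun a b : C => umap a b;
  idm := fun a => vid a;
  comp := fun a b c g f => g ⊚ f;
  comp_assoc := fun a b c d h g f => ucompA h g f;
  comp_idl := fun a b f => ucomp_idl f;
  comp_idr := fun a b f => ucomp_idr f |}.

Ltac asr := rewrite <- ?comp_assoc.
Ltac asl := rewrite -> ?comp_assoc.

(** Associativity and unitality of 1-cells are equations, so the corresponding
    equations between 2-cells have to be transported along them. *)
Definition cast2 {T : Type} (R : T -> T -> Type) {x x' y y' : T}
    (p : x = x') (q : y = y') (r : R x y) : R x' y' :=
  match p in _ = x1, q in _ = y1 return R x1 y1 with
  | eq_refl, eq_refl => r
  end.

Arguments cast2 {T} R {x x' y y'} p q r.

Record TwoCategory := {
  cell0 :> Type;
  cell1 : cell0 -> cell0 -> Type;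
  cell2 : forall a b, cell1 a b -> cell1 a b -> Type;
  id1 : forall a, cell1 a a;
  comp1 : forall a b c, cell1 b c -> cell1 a b -> cell1 a c;
  id2 : forall a b (f : cell1 a b), cell2 f f;
  vc : forall a b (f g h : cell1 a b), cell2 g h -> cell2 f g -> cell2 f h;
  hc : forall a b c (g g' : cell1 b c) (f f' : cell1 a b),
    cell2 g g' -> cell2 f f' -> cell2 (comp1 g f) (comp1 g' f');
  comp1_assoc : forall a b c d (h : cell1 c d) (g : cell1 b c) (f : cell1 a b),
    comp1 h (comp1 g f) = comp1 (comp1 h g) f;
  comp1_idl : forall a b (f : cell1 a b), comp1 (id1 b) f = f;
  comp1_idr : forall a b (f : cell1 a b), comp1 f (id1 a) = f;
  vc_assoc : forall a b (f g h k : cell1 a b)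
      (z : cell2 h k) (y : cell2 g h) (x : cell2 f g),
    vc z (vc y x) = vc (vc z y) x;
  vc_idl : forall a b (f g : cell1 a b) (x : cell2 f g), vc (id2 g) x = x;
  vc_idr : forall a b (f g : cell1 a b) (x : cell2 f g), vc x (id2 f) = x;
  hc_id : forall a b c (g : cell1 b c) (f : cell1 a b),
    hc (id2 g) (id2 f) = id2 (comp1 g f);
  hc_vc : forall a b c (g g' g'' : cell1 b c) (f f' f'' : cell1 a b)
      (y' : cell2 g' g'') (y : cell2 g g') (x' : cell2 f' f'') (x : cell2 f f'),
    hc (vc y' y) (vc x' x) = vc (hc y' x') (hc y x);
  hc_assoc : forall a b c d (h h' : cell1 c d) (g g' : cell1 b c) (f f' : cell1 a b)
      (z : cell2 h h') (y : cell2 g g') (x : cell2 f f'),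
    cast2 (@cell2 a d) (comp1_assoc h g f) (comp1_assoc h' g' f') (hc z (hc y x))
    = hc (hc z y) x;
  hc_idl : forall a b (f f' : cell1 a b) (x : cell2 f f'),
    cast2 (@cell2 a b) (comp1_idl f) (comp1_idl f') (hc (id2 (id1 b)) x) = x;
  hc_idr : forall a b (f f' : cell1 a b) (x : cell2 f f'),
    cast2 (@cell2 a b) (comp1_idr f) (comp1_idr f') (hc x (id2 (id1 a))) = x }.

Arguments cell1 {_} _ _.
Arguments cell2 {_ _ _} _ _.
Arguments id1 {_} _.
Arguments comp1 {_ _ _ _} _ _.
Arguments id2 {_ _ _} _.
Arguments vc {_ _ _ _ _ _} _ _.
Arguments hc {_ _ _ _ _ _ _ _} _ _.

Record TwoFunctor (C D : TwoCategory) := {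
  F0 :> C -> D;
  F1 : forall a b : C, cell1 a b -> cell1 (F0 a) (F0 b);
  F2 : forall (a b : C) (f g : cell1 a b), cell2 f g -> cell2 (F1 f) (F1 g);
  F1_id : forall a : C, F1 (id1 a) = id1 (F0 a);
  F1_comp : forall (a b c : C) (g : cell1 b c) (f : cell1 a b),
    F1 (comp1 g f) = comp1 (F1 g) (F1 f);
  F2_id : forall (a b : C) (f : cell1 a b), F2 (id2 f) = id2 (F1 f);
  F2_vc : forall (a b : C) (f g h : cell1 a b) (y : cell2 g h) (x : cell2 f g),
    F2 (vc y x) = vc (F2 y) (F2 x);
  F2_hc : forall (a b c : C) (g g' : cell1 b c) (f f' : cell1 a b)
      (y : cell2 g g') (x : cell2 f f'),
    cast2 (@cell2 D (F0 a) (F0 c)) (F1_comp g f) (F1_comp g' f') (F2 (hc y x))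
    = hc (F2 y) (F2 x) }.

Record VFunctor (V : MonoidalCategory) (C D : VCategory V) := {
  fob :> C -> D;
  fmap : forall a b : C, Hom (vhom a b) (vhom (fob a) (fob b));
  fmap_id : forall a, fmap a a ∘ vid a = vid (fob a);
  fmap_comp : forall a b c,
    fmap a c ∘ vcomp a b c = vcomp (fob a) (fob b) (fob c) ∘ (fmap b c ⊠ fmap a b) }.

Arguments fmap {V C D} _ _ _.

(** [pf], written [p @@ f], for [f : 𝟙 -> C(a,b)]. *)
Definition fapp {V : MonoidalCategory} {C D : VCategory V} (F : VFunctor C D)
    {a b : C} (f : umap a b) : umap (F a) (F b) := fmap F a b ∘ f.

Notation "F @@ f" := (fapp F f) (at level 30, right associativity).

(** Objects of a V-category are compared by Leibniz equality (e.g. [p e = b]),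
    so maps between hom-objects that agree only up to such an equality are
    related by [vcast]; by proof irrelevance it does not depend on the
    equality proofs. *)
Definition vcast {V : MonoidalCategory} {C : VCategory V} {a a' b b' : C}
    (p : a = a') (q : b = b') : Hom (vhom a b) (vhom a' b') :=
  match p in _ = x, q in _ = y return Hom (vhom a b) (vhom x y) with
  | eq_refl, eq_refl => idm _
  end.

Definition idto {V : MonoidalCategory} {C : VCategory V} {a b : C} (p : a = b) :
  umap a b := vcast eq_refl p ∘ vid a.

Section Casts.
Context {V : MonoidalCategory}.
Implicit Types C D : VCategory V.

Lemma vcast_refl C (a b : C) (p : a = a) (q : b = b) : vcast p q = idm _.
Proof. by rewrite (proof_irrelevance _ p eq_refl) (proof_irrelevance _ q eq_refl). Qed.

Lemma vcast1 C (a b : C) (p : a = a) (q : b = b) (X : V) (f : Hom X (vhom a b)) :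
  vcast p q ∘ f = f.
Proof. by rewrite vcast_refl comp_idl. Qed.

Lemma vcast_trans C (a a' a'' b b' b'' : C) (p : a = a') (q : b = b')
    (p' : a' = a'') (q' : b' = b'') (p'' : a = a'') (q'' : b = b'') :
  vcast p' q' ∘ vcast p q = vcast p'' q''.
Proof. subst; by rewrite !vcast_refl comp_idl. Qed.

Lemma vcast_mono C (a a' b b' : C) (p : a = a') (q : b = b') (X : V)
    (f g : Hom X (vhom a b)) : vcast p q ∘ f = vcast p q ∘ g -> f = g.
Proof. subst; by rewrite /= !comp_idl. Qed.

Lemma vcast_vcomp C (a a' b b' c c' : C) (p : a = a') (q : b = b') (r : c = c') :
  vcast p r ∘ vcomp a b c = vcomp a' b' c' ∘ (vcast q r ⊠ vcast p q).
Proof. subst; by rewrite /= tens_id comp_idl comp_idr. Qed.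

Lemma vcast_id C (a a' : C) (p q : a = a') : vcast p q ∘ vid a = vid a'.
Proof. subst; by rewrite vcast1. Qed.

Lemma vcast_ucomp C (a a' b b' c c' : C) (p : a = a') (q : b = b') (r : c = c')
    (g : umap b c) (f : umap a b) :
  vcast p r ∘ (g ⊚ f) = (vcast q r ∘ g : umap b' c') ⊚ (vcast p q ∘ f : umap a' b').
Proof. subst; by rewrite /= !comp_idl. Qed.

Lemma vcast_postcomp C (a a' b b' c c' : C) (p : a = a') (q : b = b') (r : c = c')
    (g : umap b c) :
  vcast p r ∘ postcomp a g = postcomp a' (vcast q r ∘ g : umap b' c') ∘ vcast p q.
Proof. subst; by rewrite /= !comp_idl comp_idr. Qed.

Lemma vcast_precomp C (a a' b b' c c' : C) (p : a = a') (q : b = b') (r : c = c')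
    (f : umap a b) :
  vcast p r ∘ precomp c f = precomp c' (vcast p q ∘ f : umap a' b') ∘ vcast q r.
Proof. subst; by rewrite /= !comp_idl comp_idr. Qed.

Lemma fmap_vcast C D (F : VFunctor C D) (a a' b b' : C) (p : a = a') (q : b = b') :
  fmap F a' b' ∘ vcast p q = vcast (f_equal F p) (f_equal F q) ∘ fmap F a b.
Proof. subst; by rewrite /= !comp_idl comp_idr. Qed.

Lemma fmap_ucomp C D (F : VFunctor C D) (a b c : C) (g : umap b c) (f : umap a b) :
  F @@ (g ⊚ f) = (F @@ g) ⊚ (F @@ f).
Proof. by rewrite /fapp !ucompE !comp_assoc fmap_comp -(comp_assoc (vcomp _ _ _)) -tens_comp. Qed.

Lemma fapp_id C D (F : VFunctor C D) (a : C) : F @@ vid a = vid (F a).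
Proof. exact: fmap_id. Qed.

Lemma fmap_postcomp C D (F : VFunctor C D) (a b c : C) (g : umap b c) :
  fmap F a c ∘ postcomp a g = postcomp (F a) (F @@ g) ∘ fmap F a b.
Proof.
rewrite !postcompE !comp_assoc fmap_comp -!comp_assoc lunitV_nat; congr (_ ∘ _).
by rewrite /fapp !comp_assoc -!tens_comp !comp_idl !comp_idr.
Qed.

Lemma fmap_precomp C D (F : VFunctor C D) (a b c : C) (f : umap a b) :
  fmap F a c ∘ precomp c f = precomp (F c) (F @@ f) ∘ fmap F b c.
Proof.
rewrite !precompE !comp_assoc fmap_comp -!comp_assoc runitV_nat; congr (_ ∘ _).
by rewrite /fapp !comp_assoc -!tens_comp !comp_idl !comp_idr.
Qed.

Lemma VFunctor_eq C D (F G : VFunctor C D) (H : forall x, F x = G x) :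
  (forall a b, vcast (H a) (H b) ∘ fmap F a b = fmap G a b) -> F = G.
Proof.
case: F H => Fo Fm Fi Fc; case: G => Go Gm Gi Gc /= H.
have E : Fo = Go by apply: functional_extensionality_dep.
subst Go => Hm.
have E : Fm = Gm.
  apply: functional_extensionality_dep => a; apply: functional_extensionality_dep => b.
  by rewrite -Hm vcast1.
by subst Gm; congr Build_VFunctor; apply: proof_irrelevance.
Qed.

Lemma fmap_eq C D (F G : VFunctor C D) (e : F = G) (a b : C)
    (p : F a = G a) (q : F b = G b) : vcast p q ∘ fmap F a b = fmap G a b.
Proof. subst; by rewrite vcast1. Qed.

End Casts.

Section Functors.
Context {V : MonoidalCategory}.
Implicit Types C D E : VCategory V.

Definition fid C : VFunctor C C.
Proof.
refine {| fob := fun x => x; fmap := fun a b => idm _ |}.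
- by move=> a; rewrite comp_idl.
- by move=> a b c; rewrite tens_id comp_idl comp_idr.
Defined.

Definition fcomp C D E (G : VFunctor D E) (F : VFunctor C D) : VFunctor C E.
Proof.
refine {| fob := fun x => G (F x); fmap := fun a b => fmap G (F a) (F b) ∘ fmap F a b |}.
- by move=> a; rewrite -comp_assoc !fmap_id.
- move=> a b c.
  by rewrite -comp_assoc fmap_comp comp_assoc fmap_comp -comp_assoc -tens_comp.
Defined.

Lemma fcomp_assoc C D E E' (H : VFunctor E E') (G : VFunctor D E) (F : VFunctor C D) :
  fcomp H (fcomp G F) = fcomp (fcomp H G) F.
Proof. by unshelve eapply VFunctor_eq; [move=> x; reflexivity | move=> a b; rewrite vcast1]; rewrite /= comp_assoc. Qed.

Lemma fcomp_idl C D (F : VFunctor C D) : fcomp (fid D) F = F.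
Proof. by unshelve eapply VFunctor_eq; [move=> x; reflexivity | move=> a b; rewrite vcast1]; rewrite /= comp_idl. Qed.

Lemma fcomp_idr C D (F : VFunctor C D) : fcomp F (fid C) = F.
Proof. by unshelve eapply VFunctor_eq; [move=> x; reflexivity | move=> a b; rewrite vcast1]; rewrite /= comp_idr. Qed.

Definition is_vnat C D (F G : VFunctor C D) (t : forall x, umap (F x) (G x)) : Prop :=
  forall x y,
    postcomp (F x) (t y) ∘ fmap F x y = precomp (G y) (t x) ∘ fmap G x y.

Record VNat C D (F G : VFunctor C D) := {
  ncomp :> forall x, umap (F x) (G x);
  natP : is_vnat ncomp }.

Lemma VNat_eq C D (F G : VFunctor C D) (s t : VNat F G) :
  (forall x, s x = t x) -> s = t.
Proof.
case: s => s Hs; case: t => t Ht /= e.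
have E : s = t by apply: functional_extensionality_dep.
by subst t; congr Build_VNat; apply: proof_irrelevance.
Qed.

Definition nid C D (F : VFunctor C D) : VNat F F.
Proof.
exists (fun x => vid (F x)) => x y.
by rewrite postcomp_id precomp_id.
Defined.

Lemma vnat_comp C D (F G H : VFunctor C D)
    (t : forall x, umap (G x) (H x)) (s : forall x, umap (F x) (G x)) :
  is_vnat t -> is_vnat s -> is_vnat (G := H) (fun x => t x ⊚ s x).
Proof.
move=> Ht Hs x y.
rewrite postcomp_comp precomp_comp; asr; rewrite Hs -Ht; asl.
by rewrite pre_postcomp.
Qed.

Definition nvcomp C D (F G H : VFunctor C D) (t : VNat G H) (s : VNat F G) : VNat F H :=
  {| ncomp := fun x => t x ⊚ s x; natP := vnat_comp (natP t) (natP s) |}.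

Lemma vnat_whiskerl C D E (G : VFunctor D E) (F F' : VFunctor C D)
    (s : forall x, umap (F x) (F' x)) :
  is_vnat s -> is_vnat (F := fcomp G F) (G := fcomp G F') (fun x => G @@ s x).
Proof.
move=> Hs x y /=.
asl; rewrite -(fmap_postcomp G (F x) (s y)) -(fmap_precomp G (F' y) (s x)).
by asr; rewrite (Hs x y).
Qed.

Lemma vnat_whiskerr C D E (G G' : VFunctor D E) (F : VFunctor C D)
    (t : forall x, umap (G x) (G' x)) :
  is_vnat t -> is_vnat (F := fcomp G F) (G := fcomp G' F) (fun x => t (F x)).
Proof. by move=> Ht x y /=; asl; rewrite Ht. Qed.

Definition nhcomp C D E (G G' : VFunctor D E) (F F' : VFunctor C D)
    (t : VNat G G') (s : VNat F F') : VNat (fcomp G F) (fcomp G' F').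
Proof.
exists (fun x => t (F' x) ⊚ (G @@ s x)).
apply: (@vnat_comp _ _ (fcomp G F) (fcomp G F') (fcomp G' F')).
- exact: vnat_whiskerr (natP t).
- exact: vnat_whiskerl (natP s).
Defined.

Lemma vnatu C D (F G : VFunctor C D) (t : forall x, umap (F x) (G x)) :
  is_vnat t -> forall x y (f : umap x y), t y ⊚ (F @@ f) = (G @@ f) ⊚ t x.
Proof.
move=> Ht x y f.
by rewrite -postcomp_app -precomp_app /fapp; asl; rewrite Ht.
Qed.

End Functors.

Section Isos.
Context {V : MonoidalCategory}.
Implicit Types C D : VCategory V.

Lemma visoP C (a b : C) (f : umap a b) :
  is_viso f <-> exists g : umap b a, g ⊚ f = vid a /\ f ⊚ g = vid b.
Proof.
split=> [[Hpre _]|[g [gf fg]]].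
- have [k [kK Kk]] := Hpre a; have [l [lK Kl]] := Hpre b.
  have gf : (k ∘ vid a : umap b a) ⊚ f = vid a.
    by rewrite -precomp_app comp_assoc Kk comp_idl.
  exists (k ∘ vid a); split=> //.
  rewrite -[LHS]comp_idl -[RHS]comp_idl -lK; asr.
  by rewrite !precomp_app -ucompA gf ucomp_idl ucomp_idr.
- split=> d.
  + by exists (precomp d g); rewrite -!precomp_comp gf fg !precomp_id.
  + by exists (postcomp d g); rewrite -!postcomp_comp gf fg !postcomp_id.
Qed.

Lemma viso_id C (a : C) : is_viso (vid a).
Proof. by apply/visoP; exists (vid a); rewrite ucomp_idl. Qed.

Lemma viso_comp C (a b c : C) (g : umap b c) (f : umap a b) :
  is_viso g -> is_viso f -> is_viso (g ⊚ f).
Proof.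
move=> /visoP [g' [g1 g2]] /visoP [f' [f1 f2]]; apply/visoP; exists (f' ⊚ g'); split.
- by rewrite -ucompA (ucompA g') g1 ucomp_idl.
- by rewrite -ucompA (ucompA f) f2 ucomp_idl.
Qed.

Lemma viso_fapp C D (F : VFunctor C D) (a b : C) (f : umap a b) :
  is_viso f -> is_viso (F @@ f).
Proof.
move=> /visoP [g [g1 g2]]; apply/visoP; exists (F @@ g).
by rewrite -!fmap_ucomp g1 g2 !fapp_id.
Qed.

Lemma fapp_fcomp C D (E : VCategory V) (G : VFunctor D E) (F : VFunctor C D)
    (a b : C) (f : umap a b) : fcomp G F @@ f = G @@ F @@ f.
Proof. by rewrite /fapp /= comp_assoc. Qed.

Lemma fapp_fid C (a b : C) (f : umap a b) : fid C @@ f = f.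
Proof. by rewrite /fapp /= comp_idl. Qed.
End Isos.

Section Opfibrations.
Context {V : MonoidalCategory}.
Implicit Types B E : VCategory V.

(** [e] lies over [b] through [q] and [e'] over [b'] through [q']. *)
Definition lies_over E B (p : VFunctor E B) (e e' : E) (b b' : B)
    (q : p e = b) (q' : p e' = b') (x : umap e e') (f : umap b b') : Prop :=
  vcast q q' ∘ (p @@ x) = f.

Definition opcartesian E B (p : VFunctor E B) (e e' : E) (x : umap e e') : Prop :=
  forall d : E, is_pullback (precomp d x) (fmap p e' d)
                            (fmap p e d) (precomp (p d) (p @@ x)).

Lemma lies_over_id E B (p : VFunctor E B) (e : E) (b : B) (q q' : p e = b) :
  lies_over q q' (vid e) (vid b).
Proof. by rewrite /lies_over fapp_id vcast_id. Qed.

Lemma lies_over_comp E B (p : VFunctor E B) (e e' e'' : E) (b b' b'' : B)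
    (q : p e = b) (q' : p e' = b') (q'' : p e'' = b'')
    (y : umap e' e'') (x : umap e e') (g : umap b' b'') (f : umap b b') :
  lies_over q' q'' y g -> lies_over q q' x f -> lies_over q q'' (y ⊚ x) (g ⊚ f).
Proof. by move=> <- <-; rewrite /lies_over fmap_ucomp; exact: vcast_ucomp. Qed.

End Opfibrations.

(** [push f] is [f_!e] and [chi f] is [χ(f,e)]; [e] is implicit in [f]. *)
Record Opfibration (V : MonoidalCategory) (B : VCategory V) := {
  tot : VCategory V;
  proj : VFunctor tot B;
  push : forall (e : tot) (b : B), umap (proj e) b -> tot;
  push_over : forall (e : tot) (b : B) (f : umap (proj e) b), proj (push f) = b;
  chi : forall (e : tot) (b : B) (f : umap (proj e) b), umap e (push f);
  chi_over : forall (e : tot) (b : B) (f : umap (proj e) b),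
    lies_over eq_refl (push_over f) (chi f) f;
  chi_cart : forall (e : tot) (b : B) (f : umap (proj e) b),
    opcartesian proj (chi f) }.

Record OpfibFunctor (V : MonoidalCategory) (B : VCategory V) (p q : Opfibration B) := {
  ofun :> VFunctor (tot p) (tot q);
  ofun_over : fcomp (proj q) ofun = proj p;
  ofun_cart : forall (e e' : tot p) (x : umap e e'),
    opcartesian (proj p) x -> opcartesian (proj q) (ofun @@ x) }.

Definition over_ob (V : MonoidalCategory) (B : VCategory V) (p q : Opfibration B)
    (k : OpfibFunctor p q) (e : tot p) : proj q (k e) = proj p e :=
  f_equal (fun F : VFunctor (tot p) B => F e) (ofun_over k).

Record OpfibNat (V : MonoidalCategory) (B : VCategory V) (p q : Opfibration B)
    (k k' : OpfibFunctor p q) := {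
  onat :> VNat k k';
  onat_over : forall e : tot p,
    lies_over (over_ob k e) (over_ob k' e) (onat e) (vid (proj p e)) }.

Section OpFib.
Context {V : MonoidalCategory} {B : VCategory V}.
Implicit Types p q r s : Opfibration B.

Lemma lies_over_ofun p q (k : OpfibFunctor p q) (e e' : tot p) (b b' : B)
    (u : proj p e = b) (u' : proj p e' = b')
    (w : proj q (k e) = b) (w' : proj q (k e') = b')
    (x : umap e e') (f : umap b b') :
  lies_over u u' x f -> lies_over w w' (k @@ x) f.
Proof.
rewrite /lies_over => <-; rewrite -fapp_fcomp /fapp; asl.
rewrite -(fmap_eq (ofun_over k) (over_ob k e) (over_ob k e')); asl.
by rewrite (vcast_trans _ _ _ _ w w').
Qed.

Lemma OpfibFunctor_eq p q (k k' : OpfibFunctor p q) :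
  ofun k = ofun k' -> k = k'.
Proof.
case: k => k ko kc; case: k' => k' ko' kc' /= e; subst k'.
by congr Build_OpfibFunctor; apply: proof_irrelevance.
Qed.

Lemma OpfibNat_eq p q (k k' : OpfibFunctor p q) (s t : OpfibNat k k') :
  (forall x, s x = t x) -> s = t.
Proof.
case: s => s so; case: t => t to' /= /VNat_eq e; subst t.
by congr Build_OpfibNat; apply: proof_irrelevance.
Qed.

Definition ofid p : OpfibFunctor p p.
Proof.
refine {| ofun := fid (tot p) |}.
- exact: fcomp_idr.
- by move=> e e' x; rewrite fapp_fid.
Defined.

Definition ofcomp p q r (l : OpfibFunctor q r) (k : OpfibFunctor p q) : OpfibFunctor p r.
Proof.
refine {| ofun := fcomp l k |}.
- by rewrite fcomp_assoc !ofun_over.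
- by move=> e e' x Hx; rewrite fapp_fcomp; do 2! apply: ofun_cart.
Defined.

Definition onid p q (k : OpfibFunctor p q) : OpfibNat k k.
Proof. exists (nid k) => e; exact: lies_over_id. Defined.

Definition onvcomp p q (k k' k'' : OpfibFunctor p q)
  (t : OpfibNat k' k'') (s : OpfibNat k k') : OpfibNat k k''.
Proof.
exists (nvcomp t s) => e /=.
rewrite -[vid _]ucomp_idl; apply: (lies_over_comp (q' := over_ob k' e));
  exact: onat_over.
Defined.

Definition onhcomp p q r (l l' : OpfibFunctor q r) (k k' : OpfibFunctor p q)
  (t : OpfibNat l l') (s : OpfibNat k k') : OpfibNat (ofcomp l k) (ofcomp l' k').
Proof.
exists (nhcomp t s) => e /=.
have w : proj r (l (k' e)) = proj p e by rewrite over_ob over_ob.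
rewrite -[vid _]ucomp_idl; apply: (lies_over_comp (q' := w)).
- have := onat_over t (k' e); rewrite /lies_over => H.
  have h := over_ob k' e.
  rewrite -(vcast_id h h) -H; asl; congr (_ ∘ _); symmetry; exact: vcast_trans.
- exact: (lies_over_ofun _ _ (onat_over s e)).
Defined.

Lemma cast2_onat p q (k k' l l' : OpfibFunctor p q) (u : k = k') (w : l = l')
    (s : OpfibNat k l) (e : tot p) (t : umap (k' e) (l' e)) :
  (forall (u' : k e = k' e) (w' : l e = l' e), vcast u' w' ∘ s e = t) ->
  cast2 (@OpfibNat V B p q) u w s e = t.
Proof. subst=> /(_ erefl erefl); by rewrite vcast1. Qed.

End OpFib.

Definition opFib (V : MonoidalCategory) (B : VCategory V) : TwoCategory.
Proof.
unshelve refine {|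
  cell0 := Opfibration B;
  cell1 := fun p q => OpfibFunctor p q;
  cell2 := fun p q k k' => OpfibNat k k';
  id1 := fun p => ofid p;
  comp1 := fun p q r l k => ofcomp l k;
  id2 := fun p q k => onid k;
  vc := fun p q k k' k'' t s => onvcomp t s;
  hc := fun p q r l l' k k' t s => onhcomp t s |}.
- by move=> p q r s m l k; apply: OpfibFunctor_eq; exact: fcomp_assoc.
- by move=> p q k; apply: OpfibFunctor_eq; exact: fcomp_idl.
- by move=> p q k; apply: OpfibFunctor_eq; exact: fcomp_idr.
- by move=> *; apply: OpfibNat_eq => e /=; rewrite ucompA.
- by move=> *; apply: OpfibNat_eq => e /=; rewrite ucomp_idl.
- by move=> *; apply: OpfibNat_eq => e /=; rewrite ucomp_idr.
- by move=> *; apply: OpfibNat_eq => e /=; rewrite fapp_id ucomp_idl.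
- move=> p q r l l' l'' k k' k'' t' t s' s; apply: OpfibNat_eq => e /=.
  rewrite fmap_ucomp -!ucompA; congr (_ ⊚ _).
  by rewrite !ucompA (vnatu (natP t)).
- move=> p q r s m m' l l' k k' z y x; apply: OpfibNat_eq => e.
  apply: cast2_onat => u w; apply: etrans; [exact: vcast1|]; rewrite /=.
  by rewrite fmap_ucomp fapp_fcomp ucompA.
- move=> p q k k' x; apply: OpfibNat_eq => e.
  by apply: cast2_onat => u w; apply: etrans; [exact: vcast1|]; rewrite /= fapp_fid ucomp_idl.
- move=> p q k k' x; apply: OpfibNat_eq => e.
  by apply: cast2_onat => u w; apply: etrans; [exact: vcast1|]; rewrite /= fapp_id ucomp_idr.
Defined.

(** [psid] is [ξ] and [pscomp] is [θ], as bare families of components; their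
    naturality, invertibility and coherence are imposed in [Pseudofunctor]. *)
Record PseudofunctorData (V : MonoidalCategory) (B : Category) := {
  psob :> B -> VCategory V;
  psmap : forall b c : B, Hom b c -> VFunctor (psob b) (psob c);
  psid : forall (b : B) (x : psob b), umap (psmap (idm b) x) x;
  pscomp : forall (b c d : B) (f : Hom b c) (g : Hom c d) (x : psob b),
    umap (psmap (g ∘ f) x) (psmap g (psmap f x)) }.

Arguments psmap {V B} _ {b c} _.
Arguments psid {V B} _ _ _.
Arguments pscomp {V B} _ {b c d} _ _ _.

Record Pseudofunctor (V : MonoidalCategory) (B : Category) := {
  psdata :> PseudofunctorData V B;
  psid_nat : forall b : B,
    is_vnat (F := psmap psdata (idm b)) (G := fid (psdata b)) (psid psdata b);
  psid_iso : forall (b : B) (x : psdata b), is_viso (psid psdata b x);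
  pscomp_nat : forall (b c d : B) (f : Hom b c) (g : Hom c d),
    is_vnat (F := psmap psdata (g ∘ f)) (G := fcomp (psmap psdata g) (psmap psdata f))
      (pscomp psdata f g);
  pscomp_iso : forall (b c d : B) (f : Hom b c) (g : Hom c d) (x : psdata b),
    is_viso (pscomp psdata f g x);
  ps_unitl : forall (b c : B) (f : Hom b c) (x : psdata b),
    (psmap psdata f @@ psid psdata b x) ⊚ pscomp psdata (idm b) f x
    = idto (f_equal (fun h => psmap psdata h x) (comp_idr f));
  ps_unitr : forall (b c : B) (f : Hom b c) (x : psdata b),
    psid psdata c (psmap psdata f x) ⊚ pscomp psdata f (idm c) x
    = idto (f_equal (fun h => psmap psdata h x) (comp_idl f));
  ps_assoc : forall (a b c d : B) (f : Hom a b) (g : Hom b c) (h : Hom c d) (x : psdata a),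
    vcast (f_equal (fun k => psmap psdata k x) (comp_assoc h g f)) eq_refl
      ∘ ((psmap psdata h @@ pscomp psdata f g x) ⊚ pscomp psdata (g ∘ f) h x)
    = pscomp psdata g h (psmap psdata f x) ⊚ pscomp psdata f (h ∘ g) x }.

Record PseudoNat (V : MonoidalCategory) (B : Category) (F G : Pseudofunctor V B) := {
  pnob :> forall b : B, VFunctor (F b) (G b);
  pnmap : forall (b c : B) (f : Hom b c),
    VNat (fcomp (psmap G f) (pnob b)) (fcomp (pnob c) (psmap F f));
  pnmap_iso : forall (b c : B) (f : Hom b c) (x : F b), is_viso (pnmap f x);
  pn_comp : forall (b c d : B) (f : Hom b c) (g : Hom c d) (x : F b),
    (pnob d @@ pscomp F f g x) ⊚ pnmap (g ∘ f) x
    = pnmap g (psmap F f x) ⊚ (psmap G g @@ pnmap f x) ⊚ pscomp G f g (pnob b x);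
  pn_id : forall (b : B) (x : F b),
    (pnob b @@ psid F b x) ⊚ pnmap (idm b) x = psid G b (pnob b x) }.

Arguments pnmap {V B F G} _ {b c} _.

Record Modification (V : MonoidalCategory) (B : Category) (F G : Pseudofunctor V B)
    (al be : PseudoNat F G) := {
  modif :> forall b : B, VNat (al b) (be b);
  modif_nat : forall (b c : B) (f : Hom b c) (x : F b),
    modif c (psmap F f x) ⊚ pnmap al f x
    = pnmap be f x ⊚ (psmap G f @@ modif b x) }.

Section FunPs.
Context {V : MonoidalCategory} {B : Category}.
Implicit Types F G H K : Pseudofunctor V B.

Lemma PseudoNat_eq F G (al be : PseudoNat F G) (e : forall b, al b = be b) :
  (forall (b c : B) (f : Hom b c) (x : F b)
     (u : psmap G f (al b x) = psmap G f (be b x))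
     (w : al c (psmap F f x) = be c (psmap F f x)),
   vcast u w ∘ pnmap al f x = pnmap be f x) -> al = be.
Proof.
case: al e => ao am ai ac au; case: be => bo bm bi bc bu /= e.
have E : ao = bo by apply: functional_extensionality_dep.
subst bo => Hm.
have E : am = bm.
  do 3! apply: functional_extensionality_dep => ?; apply: VNat_eq => x.
  by rewrite -(Hm _ _ _ _ erefl erefl) comp_idl.
by subst bm; congr Build_PseudoNat; apply: proof_irrelevance.
Qed.

Lemma Modification_eq F G (al be : PseudoNat F G) (s t : Modification al be) :
  (forall b x, s b x = t b x) -> s = t.
Proof.
case: s => s sn; case: t => t tn /= e.
have E : s = t by apply: functional_extensionality_dep => b; exact: VNat_eq.
by subst t; congr Build_Modification; apply: proof_irrelevance.
Qed.

Definition pnid F : PseudoNat F F.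
Proof.
unshelve refine {| pnob := fun b => fid (F b);
  pnmap := fun b c f => @Build_VNat _ _ _
    (fcomp (psmap F f) (fid (F b))) (fcomp (fid (F c)) (psmap F f))
    (fun x => vid (psmap F f x)) _ |}.
- by move=> x y /=; rewrite postcomp_id precomp_id !comp_idl comp_idr.
- by move=> b c f x; exact: viso_id.
- by move=> b c d f g x /=; rewrite !fapp_fid fapp_id !ucomp_idl ucomp_idr.
- by move=> b x /=; rewrite fapp_fid ucomp_idr.
Defined.

Definition pncomp F G H (be : PseudoNat G H) (al : PseudoNat F G) : PseudoNat F H.
Proof.
unshelve refine {| pnob := fun b => fcomp (be b) (al b);
  pnmap := fun b c f => @Build_VNat _ _ _
    (fcomp (psmap H f) (fcomp (be b) (al b))) (fcomp (fcomp (be c) (al c)) (psmap F f))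
    (fun x => (be c @@ pnmap al f x) ⊚ pnmap be f (al b x)) _ |}.
- have H1 := vnat_whiskerl (be c) (natP (pnmap al f)).
  have H2 := vnat_whiskerr (al b) (natP (pnmap be f)).
  move=> x y /=.
  rewrite postcomp_comp precomp_comp.
  have := H1 x y; have := H2 x y => /=; asr => h2 h1.
  by rewrite h2 -h1; asl; rewrite pre_postcomp.
- by move=> b c f x; apply: viso_comp; [apply: viso_fapp|]; exact: pnmap_iso.
- move=> b c d f g x /=.
  rewrite !fapp_fcomp !ucompA -fmap_ucomp pn_comp !fmap_ucomp -!ucompA; congr (_ ⊚ _).
  rewrite pn_comp !ucompA; congr (_ ⊚ _ ⊚ _).
  by have := vnatu (natP (pnmap be g)) (pnmap al f x); rewrite !fapp_fcomp => ->.
- by move=> b x /=; rewrite fapp_fcomp ucompA -fmap_ucomp pn_id pn_id.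
Defined.

Definition mdid F G (al : PseudoNat F G) : Modification al al.
Proof.
exists (fun b => nid (al b)) => b c f x /=.
by rewrite fapp_id ucomp_idl ucomp_idr.
Defined.

Definition mdvcomp F G (al be ga : PseudoNat F G)
  (t : Modification be ga) (s : Modification al be) : Modification al ga.
Proof.
exists (fun b => nvcomp (t b) (s b)) => b c f x /=.
by rewrite fmap_ucomp -ucompA modif_nat !ucompA modif_nat.
Defined.

Definition mdhcomp F G H (be be' : PseudoNat G H) (al al' : PseudoNat F G)
  (t : Modification be be') (s : Modification al al') :
  Modification (pncomp be al) (pncomp be' al').
Proof.
exists (fun b => nhcomp (t b) (s b)) => b c f x /=.
rewrite fmap_ucomp !ucompA -(ucompA (t _ _)) -fmap_ucomp modif_nat.
rewrite (vnatu (natP (t c))) fmap_ucomp -!ucompA; congr (_ ⊚ _).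
have := vnatu (natP (pnmap be' f)) (s b x); rewrite !fapp_fcomp => E.
by rewrite modif_nat -fmap_ucomp (vnatu (natP (t b))) fmap_ucomp !ucompA E.
Defined.

Lemma cast2_modif F G (al al' be be' : PseudoNat F G) (u : al = al') (w : be = be')
    (s : Modification al be) (b : B) (x : F b) (t : umap (al' b x) (be' b x)) :
  (forall (u' : al b x = al' b x) (w' : be b x = be' b x), vcast u' w' ∘ s b x = t) ->
  cast2 (@Modification V B F G) u w s b x = t.
Proof. subst=> /(_ erefl erefl); by rewrite vcast1. Qed.

End FunPs.

Definition FunPs (V : MonoidalCategory) (B : Category) : TwoCategory.
Proof.
unshelve refine {|
  cell0 := Pseudofunctor V B;
  cell1 := fun F G => PseudoNat F G;
  cell2 := fun F G al be => Modification al be;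
  id1 := fun F => pnid F;
  comp1 := fun F G H be al => pncomp be al;
  id2 := fun F G al => mdid al;
  vc := fun F G al be ga t s => mdvcomp t s;
  hc := fun F G H be be' al al' t s => mdhcomp t s |}.
- move=> F G H K ga be al; apply: PseudoNat_eq => [b|b c f x u w] /=.
    exact: fcomp_assoc.
  by apply: etrans; [exact: vcast1|]; rewrite fmap_ucomp fapp_fcomp ucompA.
- move=> F G al; apply: PseudoNat_eq => [b|b c f x u w] /=.
    exact: fcomp_idl.
  by apply: etrans; [exact: vcast1|]; rewrite fapp_fid ucomp_idr.
- move=> F G al; apply: PseudoNat_eq => [b|b c f x u w] /=.
    exact: fcomp_idr.
  by apply: etrans; [exact: vcast1|]; rewrite fapp_id ucomp_idl.
- by move=> *; apply: Modification_eq => b x /=; rewrite ucompA.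
- by move=> *; apply: Modification_eq => b x /=; rewrite ucomp_idl.
- by move=> *; apply: Modification_eq => b x /=; rewrite ucomp_idr.
- by move=> *; apply: Modification_eq => b x /=; rewrite fapp_id ucomp_idl.
- move=> F G H be be' be'' al al' al'' t' t s' s; apply: Modification_eq => b x /=.
  rewrite fmap_ucomp -!ucompA; congr (_ ⊚ _).
  by rewrite !ucompA (vnatu (natP (t b))).
- move=> F G H K ga ga' be be' al al' z y s; apply: Modification_eq => b x.
  apply: cast2_modif => u w; apply: etrans; [exact: vcast1|]; rewrite /=.
  by rewrite fmap_ucomp fapp_fcomp ucompA.
- move=> F G al al' s; apply: Modification_eq => b x.
  by apply: cast2_modif => u w; apply: etrans; [exact: vcast1|]; rewrite /= fapp_fid ucomp_idl.
- move=> F G al al' s; apply: Modification_eq => b x.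
  by apply: cast2_modif => u w; apply: etrans; [exact: vcast1|]; rewrite /= fapp_id ucomp_idr.
Defined.

Section Fibers.
Context {V : MonoidalCategory} (PB : Pullbacks V) {B : VCategory V} (p : Opfibration B).

Record FibOb (b : B) := {
  fe :> tot p;
  fe_over : proj p fe = b }.

Definition toB (b b' : B) (e : FibOb b) (e' : FibOb b') : Hom (vhom (fe e) (fe e')) (vhom b b') :=
  vcast (fe_over e) (fe_over e') ∘ fmap (proj p) e e'.

Definition fhomP (b : B) (e e' : FibOb b) : Pullback (toB e e') (vid b) :=
  PB (toB e e') (vid b).

Definition fhom (b : B) (e e' : FibOb b) : V := apex (fhomP e e').

Definition fincl (b : B) (e e' : FibOb b) : Hom (fhom e e') (vhom (fe e) (fe e')) :=
  pr1 (fhomP e e').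

Definition fpt (b : B) (e e' : FibOb b) : Hom (fhom e e') 𝟙 := pr2 (fhomP e e').

Lemma fib_comm (b : B) (e e' : FibOb b) : toB e e' ∘ fincl e e' = vid b ∘ fpt e e'.
Proof. exact: (pb_comm (pullbackP (fhomP e e'))). Qed.

Lemma fib_ext (b : B) (e e' : FibOb b) (X : V) (u v : Hom X (fhom e e')) :
  fincl e e' ∘ u = fincl e e' ∘ v -> fpt e e' ∘ u = fpt e e' ∘ v -> u = v.
Proof. exact: (pb_ext (pullbackP (fhomP e e'))). Qed.

Definition flift (b : B) (e e' : FibOb b) (X : V) (x : Hom X (vhom (fe e) (fe e')))
    (t : Hom X 𝟙) (H : toB e e' ∘ x = vid b ∘ t) : Hom X (fhom e e') :=
  pb_lift (pullbackP (fhomP e e')) H.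

Lemma flift1 (b : B) (e e' : FibOb b) (X : V) (x : Hom X (vhom (fe e) (fe e')))
    (t : Hom X 𝟙) (H : toB e e' ∘ x = vid b ∘ t) : fincl e e' ∘ flift H = x.
Proof. exact: pb_lift1. Qed.

Lemma flift2 (b : B) (e e' : FibOb b) (X : V) (x : Hom X (vhom (fe e) (fe e')))
    (t : Hom X 𝟙) (H : toB e e' ∘ x = vid b ∘ t) : fpt e e' ∘ flift H = t.
Proof. exact: pb_lift2. Qed.

Lemma toB_lies_over (b b' : B) (e : FibOb b) (e' : FibOb b') (x : umap (fe e) (fe e'))
    (f : umap b b') :
  lies_over (fe_over e) (fe_over e') x f <-> toB e e' ∘ x = f.
Proof. by rewrite /lies_over /toB /fapp -comp_assoc. Qed.

Lemma toB_comp (b b' b'' : B) (e : FibOb b) (e' : FibOb b') (e'' : FibOb b'') :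
  toB e e'' ∘ vcomp (fe e) (fe e') (fe e'') = vcomp b b' b'' ∘ (toB e' e'' ⊠ toB e e').
Proof.
rewrite /toB -comp_assoc fmap_comp comp_assoc.
by rewrite (vcast_vcomp (fe_over e) (fe_over e') (fe_over e'')) -comp_assoc -tens_comp.
Qed.

Lemma toB_id (b : B) (e : FibOb b) : toB e e ∘ vid (fe e) = vid b ∘ idm 𝟙.
Proof. by rewrite comp_idr; apply/toB_lies_over; exact: lies_over_id. Qed.

Lemma toB_postcomp (b b' b'' : B) (e : FibOb b) (e' : FibOb b') (e'' : FibOb b'')
    (x : umap (fe e') (fe e'')) :
  toB e e'' ∘ postcomp (fe e) x = postcomp b (toB e' e'' ∘ x : umap b' b'') ∘ toB e e'.
Proof.
rewrite /toB -comp_assoc fmap_postcomp comp_assoc.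
by rewrite (vcast_postcomp (fe_over e) (fe_over e') (fe_over e'')) /fapp -!comp_assoc.
Qed.

Lemma toB_precomp (b b' b'' : B) (e : FibOb b) (e' : FibOb b') (e'' : FibOb b'')
    (x : umap (fe e) (fe e')) :
  toB e e'' ∘ precomp (fe e'') x = precomp b'' (toB e e' ∘ x : umap b b') ∘ toB e' e''.
Proof.
rewrite /toB -comp_assoc fmap_precomp comp_assoc.
by rewrite (vcast_precomp (fe_over e) (fe_over e') (fe_over e'')) /fapp -!comp_assoc.
Qed.

Lemma vcomp_vid (C : VCategory V) (b : C) : vcomp b b b ∘ (vid b ⊠ vid b) = vid b ∘ lunit 𝟙.
Proof.
by rewrite -{1}[vid b]comp_idr -{2}[vid b]comp_idl tens_comp comp_assoc vcomp_idl lunit_nat.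
Qed.

Lemma fcompP (b : B) (e e' e'' : FibOb b) :
  toB e e'' ∘ (vcomp (fe e) (fe e') (fe e'') ∘ (fincl e' e'' ⊠ fincl e e'))
  = vid b ∘ (lunit 𝟙 ∘ (fpt e' e'' ⊠ fpt e e')).
Proof.
rewrite comp_assoc (toB_comp e e' e'') -comp_assoc -tens_comp !fib_comm tens_comp.
by rewrite !comp_assoc vcomp_vid.
Qed.

(** The fiber over [b]; identities and composition are those making
    [fincl] and [fpt] compatible with the structure of [tot p] and of [𝟙]. *)
Definition fiber (b : B) : VCategory V.
Proof.
refine {| vob := FibOb b;
  vhom := fun e e' => fhom e e';
  vid := fun e => flift (toB_id e);
  vcomp := fun e e' e'' => flift (fcompP e e' e'') |}.
- move=> e1 e2 e3 e4; apply: fib_ext; rewrite -?comp_assoc.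
  + rewrite !(comp_assoc (fincl _ _)) !flift1.
    rewrite -!comp_assoc (comp_assoc (fincl _ _ ⊠ _)) -!tens_comp !flift1 !comp_idr.
    rewrite tens_splitl tens_splitr comp_assoc vcomp_assoc -!comp_assoc.
    by rewrite assoc_nat.
  + rewrite !(comp_assoc (fpt _ _)) !flift2.
    rewrite -!comp_assoc (comp_assoc (fpt _ _ ⊠ _)) -!tens_comp !flift2 !comp_idr.
    rewrite tens_splitl tens_splitr {2}lunit_runit -triangle -!comp_assoc.
    by rewrite assoc_nat.
- move=> e e'; apply: fib_ext; rewrite comp_assoc.
  + rewrite flift1 -comp_assoc -tens_comp flift1 comp_idr.
    rewrite -[vid _]comp_idr -[fincl _ _]comp_idl tens_comp comp_assoc vcomp_idl.
    by rewrite lunit_nat comp_idl.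
  + by rewrite flift2 -comp_assoc -tens_comp flift2 comp_idr lunit_nat.
- move=> e e'; apply: fib_ext; rewrite comp_assoc.
  + rewrite flift1 -comp_assoc -tens_comp flift1 comp_idr.
    rewrite -[vid _]comp_idr -[fincl _ _]comp_idl tens_comp comp_assoc vcomp_idr.
    by rewrite runit_nat comp_idl.
  + by rewrite flift2 -comp_assoc -tens_comp flift2 comp_idr lunit_runit runit_nat.
Defined.

Definition in_fiber (b : B) (e e' : FibOb b) (x : umap (fe e) (fe e'))
    (H : lies_over (fe_over e) (fe_over e') x (vid b)) : umap (e : fiber b) (e' : fiber b) :=
  flift (eq_trans (proj1 (toB_lies_over x (vid b)) H) (eq_sym (comp_idr (vid b)))).

(** [f_!e] and [χ(f,e)] for [e] over [b] and [f : b -> b']. *)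
Definition fpush (b b' : B) (f : umap b b') (e : FibOb b) : FibOb b' :=
  {| fe := push (vcast (eq_sym (fe_over e)) eq_refl ∘ f : umap (proj p e) b');
     fe_over := push_over _ |}.

Definition fchi (b b' : B) (f : umap b b') (e : FibOb b) : umap (fe e) (fe (fpush f e)) :=
  chi (vcast (eq_sym (fe_over e)) eq_refl ∘ f : umap (proj p e) b').

Lemma fchi_over (b b' : B) (f : umap b b') (e : FibOb b) :
  lies_over (fe_over e) (fe_over (fpush f e)) (fchi f e) f.
Proof.
have H := chi_over (vcast (eq_sym (fe_over e)) eq_refl ∘ f : umap (proj p e) b').
have E : vcast (fe_over e) eq_refl ∘ (vcast (eq_sym (fe_over e)) eq_refl ∘ f) = f.
  by rewrite comp_assoc (vcast_trans _ _ _ _ eq_refl eq_refl) comp_idl.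
apply: (etrans _ E); rewrite /lies_over in H *.
apply: (etrans _ (f_equal (fun g => vcast (fe_over e) eq_refl ∘ g) H)).
rewrite [RHS]comp_assoc; congr (_ ∘ _).
by rewrite (vcast_trans _ _ _ _ (fe_over e) (fe_over (fpush f e))).
Qed.

Lemma fchi_cart (b b' : B) (f : umap b b') (e : FibOb b) : opcartesian (proj p) (fchi f e).
Proof. exact: chi_cart. Qed.

Lemma opcart_univ (b b' c : B) (e : FibOb b) (e' : FibOb b') (d : FibOb c)
    (f : umap b b') (x : umap (fe e) (fe e')) (X : V)
    (u : Hom X (vhom (fe e) (fe d))) (v : Hom X (vhom b' c)) :
  opcartesian (proj p) x -> toB e e' ∘ x = f ->
  toB e d ∘ u = precomp c f ∘ v ->
  exists! w : Hom X (vhom (fe e') (fe d)), precomp (fe d) x ∘ w = u /\ toB e' d ∘ w = v.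
Proof.
move=> Hx Hf Huv.
have E : vcast (fe_over e') (fe_over d)
     ∘ (vcast (eq_sym (fe_over e')) (eq_sym (fe_over d)) ∘ v) = v.
  by rewrite comp_assoc (vcast_trans _ _ _ _ eq_refl eq_refl) comp_idl.
have [|w [[w1 w2] wu]] := pb_univ (Hx d) (q1 := u)
    (q2 := vcast (eq_sym (fe_over e')) (eq_sym (fe_over d)) ∘ v).
  apply: (vcast_mono (p := fe_over e) (q := fe_over d)).
  move: Huv; rewrite -{}Hf /toB -comp_assoc => ->.
  rewrite [RHS]comp_assoc (vcast_precomp (fe_over e) (fe_over e') (fe_over d)).
  by rewrite -[in RHS]comp_assoc E /fapp comp_assoc.
exists w; split.
- by split=> //; rewrite /toB -comp_assoc w2.
- move=> w' [w1' w2']; apply: wu; split=> //.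
  by apply: (vcast_mono (p := fe_over e') (q := fe_over d)); rewrite E comp_assoc.
Qed.

Lemma epsP (b b' : B) (e : FibOb b) (e' : FibOb b') (f : umap b b')
    (x : umap (fe e) (fe e')) :
  lies_over (fe_over e) (fe_over e') x f ->
  exists! y : umap (fe (fpush f e)) (fe e'),
    lies_over (fe_over (fpush f e)) (fe_over e') y (vid b') /\ y ⊚ fchi f e = x.
Proof.
move=> /toB_lies_over Hx.
have [|y [[y1 y2] yu]] := opcart_univ (d := e') (u := x) (v := vid b')
    (@fchi_cart _ _ f e) (proj1 (toB_lies_over _ _) (fchi_over f e)).
  by rewrite precomp_app ucomp_idl.
exists y; split; first by split; [apply/toB_lies_over|rewrite -precomp_app].
by move=> y' [/toB_lies_over h1 h2]; apply: yu; rewrite precomp_app.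
Qed.

(** The unique map [ε_x : f_!e -> e'] over the identity with [ε_x χ(f,e) = x],
    where [f], a parameter, is the image of [x] read between [b] and [b'].
    It exists for every [x], and is invertible when [x] is opcartesian. *)
Definition eps (b b' : B) (e : FibOb b) (e' : FibOb b') (f : umap b b')
    (x : umap (fe e) (fe e')) (H : lies_over (fe_over e) (fe_over e') x f) :
    umap (fe (fpush f e)) (fe e') :=
  proj1_sig (constructive_indefinite_description _ (epsP H)).

Lemma eps_over (b b' : B) (e : FibOb b) (e' : FibOb b') (f : umap b b')
    (x : umap (fe e) (fe e')) (H : lies_over (fe_over e) (fe_over e') x f) :
  lies_over (fe_over (fpush f e)) (fe_over e') (eps H) (vid b').
Proof. by rewrite /eps; case: constructive_indefinite_description => y [[]]. Qed.

Lemma eps_chi (b b' : B) (e : FibOb b) (e' : FibOb b') (f : umap b b')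
    (x : umap (fe e) (fe e')) (H : lies_over (fe_over e) (fe_over e') x f) :
  eps H ⊚ fchi f e = x.
Proof. by rewrite /eps; case: constructive_indefinite_description => y [[]]. Qed.

Lemma fpush_ext (b b' : B) (f : umap b b') (e : FibOb b) (d : FibOb b') (X : V)
    (u v : Hom X (fhom (fpush f e) d)) :
  fpt (fpush f e) d ∘ u = fpt (fpush f e) d ∘ v ->
  precomp (fe d) (fchi f e) ∘ (fincl (fpush f e) d ∘ u)
  = precomp (fe d) (fchi f e) ∘ (fincl (fpush f e) d ∘ v) -> u = v.
Proof.
move=> e1 e2; apply: fib_ext => //.
apply: (pb_ext (@fchi_cart _ _ f e d)) => //.
apply: (vcast_mono (p := fe_over (fpush f e)) (q := fe_over d)).
by rewrite !(comp_assoc (vcast _ _)) -/(toB _ _) !comp_assoc fib_comm -!comp_assoc e1.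
Qed.

Lemma transportP (b b' : B) (f : umap b b') (e e' : FibOb b) :
  exists! T : Hom (fhom e e') (fhom (fpush f e) (fpush f e')),
    fpt _ _ ∘ T = fpt _ _ /\
    precomp _ (fchi f e) ∘ fincl _ _ ∘ T = postcomp _ (fchi f e') ∘ fincl _ _.
Proof.
have [|w [[w1 w2] _]] := opcart_univ (d := fpush f e')
    (u := postcomp (fe e) (fchi f e') ∘ fincl e e') (v := vid b' ∘ fpt e e')
    (@fchi_cart _ _ f e) (proj1 (toB_lies_over _ _) (fchi_over f e)).
  rewrite comp_assoc toB_postcomp.
  rewrite (proj1 (toB_lies_over _ _) (fchi_over f e')) -comp_assoc fib_comm.
  by asl; rewrite postcomp_app precomp_app ucomp_idl ucomp_idr.
exists (flift w2); split.
- by split; [exact: flift2|rewrite -comp_assoc flift1].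
- move=> T [T1 T2]; apply: fpush_ext; first by rewrite flift2.
  by rewrite flift1 w1 -T2 comp_assoc.
Qed.

(** Determined uniquely by [transport_pt] and [transport_chi]. *)
Definition transport_hom (b b' : B) (f : umap b b') (e e' : FibOb b) :
    Hom (fhom e e') (fhom (fpush f e) (fpush f e')) :=
  proj1_sig (constructive_indefinite_description _ (transportP f e e')).

Lemma transport_pt (b b' : B) (f : umap b b') (e e' : FibOb b) :
  fpt _ _ ∘ transport_hom f e e' = fpt _ _.
Proof. by rewrite /transport_hom; case: constructive_indefinite_description => y [[]]. Qed.

Lemma transport_chi (b b' : B) (f : umap b b') (e e' : FibOb b) :
  precomp _ (fchi f e) ∘ (fincl _ _ ∘ transport_hom f e e')
  = postcomp _ (fchi f e') ∘ fincl _ _.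
Proof.
by rewrite comp_assoc /transport_hom; case: constructive_indefinite_description => y [[]].
Qed.

Definition transport (b b' : B) (f : umap b b') : VFunctor (fiber b) (fiber b').
Proof.
refine (@Build_VFunctor _ (fiber b) (fiber b') (fpush f) (transport_hom f) _ _).
- move=> e; apply: fpush_ext.
  + by rewrite comp_assoc transport_pt !flift2.
  + rewrite (comp_assoc (fincl _ _)) (comp_assoc (precomp _ _)) transport_chi.
    by asr; rewrite !flift1 postcomp_app precomp_app ucomp_idl ucomp_idr.
- move=> e e' e''; apply: fpush_ext.
  + rewrite !comp_assoc transport_pt !flift2; asr.
    by rewrite -tens_comp !transport_pt.
  + rewrite (comp_assoc (fincl _ _)) (comp_assoc (precomp _ _)) transport_chi.
    rewrite (comp_assoc (fincl _ _)) !flift1; asr; rewrite flift1 -tens_comp.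
    rewrite comp_assoc -vcomp_precomp -comp_assoc -tens_comp comp_idl transport_chi.
    rewrite tens_splitr comp_assoc -vcomp_prepost -comp_assoc -tens_splitl.
    by rewrite transport_chi tens_splitl !comp_assoc vcomp_postcomp.
Defined.

Lemma lies_over_vid (b : B) (e : FibOb b) : lies_over (fe_over e) (fe_over e) (vid (fe e)) (vid b).
Proof. exact: lies_over_id. Qed.

Lemma fchi_comp_over (b c d : B) (f : umap b c) (g : umap c d) (e : FibOb b) :
  lies_over (fe_over e) (fe_over (fpush g (fpush f e)))
    (fchi g (fpush f e) ⊚ fchi f e) (g ⊚ f).
Proof. exact: (lies_over_comp (fchi_over g (fpush f e)) (fchi_over f e)). Qed.

Definition inverse_grothendieck : PseudofunctorData V (underlying B) :=
  @Build_PseudofunctorData V (underlying B)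
    (fun b => fiber b)
    (fun b c f => transport f)
    (fun b e => in_fiber (eps_over (lies_over_vid e)))
    (fun b c d f g e => in_fiber (eps_over (fchi_comp_over f g e))).

End Fibers.

(* Main.v *)
From Stdlib Require Import ssreflect ssrfun ProofIrrelevance.
Require Import Defs.

(** The structure 2-cells of the pseudofunctors and of the pseudonatural
    transformations are all comparisons of opcartesian lifts: [ξ], [θ] and the cells [α_f : f_! k e -> k f_! e] of an opfibered functor [k] are the maps
    [ε_x] for [x] the opcartesian map [1_e], [χ(g,f_!e) χ(f,e)] and [k χ(f,e)]
    respectively.  So each is invertible ([eps_iso]), and each is characterized by
    its composite with the chosen lift [χ] ([xi_chi], [theta_chi], [alpha_chi]).

    An equation between 2-cells out of [f_!e] can then be tested after composing
    with [χ(f,e)] in the total category ([push_map_ext]).  There it is immediate: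
    all composites with chosen lifts collapse by the characterizations above and by
    [f_!(x) χ = χ x] ([transport_map]).  The naturality in [V] of a family out of
    [f_! D] reduces in the same way to the naturality of its composite with [χ]
    ([push_natural]), where it follows from that of [χ] ([chi_natural]).

    Maps of a fiber are handled through two V-functors, the inclusion [incl] into
    the total category and the projection [pt] to the unit V-category, which are
    jointly faithful because the hom-objects of a fiber are pullbacks.  A family
    lying over identities restricts to the fibers, giving a modification [gamma].

    The functoriality equations compare V-functors and 2-cells whose endpoints are
    the same objects with different proofs of lying over [b].  The casts between
    them disappear under [incl], where these endpoints coincide ([incl_cast],
    [cast_push_chi], [fiber_functor_ext]). *)

Set Implicit Arguments.
Unset Strict Implicit.
Unset Printing Implicit Defensive.

(** * Fibers inside the total category *)

(** The target that makes the projections of the fiber hom-objects to [𝟙] into a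
    V-functor. *)
Definition unit_vcat (V : MonoidalCategory) : VCategory V.
Proof.
refine {| vob := unit; vhom := fun _ _ => 𝟙; vid := fun _ => idm 𝟙;
          vcomp := fun _ _ _ => lunit 𝟙 |}.
- by move=> *; rewrite -comp_assoc triangle lunit_runit.
- by move=> *; rewrite tens_id comp_idr.
- by move=> *; rewrite tens_id comp_idr lunit_runit.
Defined.

Section Fibers.
Context {V : MonoidalCategory} (PB : Pullbacks V) {B : VCategory V} (p : Opfibration B).
Implicit Types b c d : B.

Definition incl b : VFunctor (fiber PB p b) (tot p).
Proof.
refine (@Build_VFunctor _ (fiber PB p b) (tot p) (fun e => fe e) (fincl PB (b:=b)) _ _).
- by move=> e /=; rewrite flift1.
- by move=> e e' e'' /=; rewrite flift1.
Defined.

Definition pt b : VFunctor (fiber PB p b) (unit_vcat V).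
Proof.
refine (@Build_VFunctor _ (fiber PB p b) (unit_vcat V) (fun _ => tt) (fpt PB (b:=b)) _ _).
- by move=> e /=; rewrite flift2.
- by move=> e e' e'' /=; rewrite flift2.
Defined.

(** A global element of a fiber hom-object is a map [x] of the total category with some
    [t : 𝟙 -> 𝟙] such that [x] lies over [1_b ∘ t]: as [𝟙] need not be terminal, [x] need
    not determine [t].  The maps over [1_b] are given by the elements with [t] the
    identity. *)
Definition vertical b (e e' : fiber PB p b) (x : umap e e') : Prop :=
  pt b @@ x = vid (tt : unit_vcat V).

Lemma vertical_id b (e : fiber PB p b) : vertical (vid e).
Proof. exact: fapp_id. Qed.

Lemma vertical_comp b (e e' e'' : fiber PB p b) (y : umap e' e'') (x : umap e e') :
  vertical y -> vertical x -> vertical (y ⊚ x).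
Proof. by rewrite /vertical fmap_ucomp => -> ->; rewrite ucomp_idl. Qed.

Lemma vertical_cast b (e e' d d' : fiber PB p b) (u : e = d) (w : e' = d') (x : umap e e') :
  vertical x -> vertical (vcast u w ∘ x : umap d d').
Proof. by subst; rewrite /= comp_idl. Qed.

Lemma vertical_transport b c (f : umap b c) (e e' : fiber PB p b) (x : umap e e') :
  vertical x -> vertical (transport PB p f @@ x).
Proof. by rewrite /vertical -!fapp_fcomp /fapp /= transport_pt. Qed.

Lemma vertical_in_fiber b (e e' : FibOb p b) (x : umap (fe e) (fe e'))
    (H : lies_over (fe_over e) (fe_over e') x (vid b)) : vertical (in_fiber PB H).
Proof. by rewrite /vertical /fapp /= flift2. Qed.

Lemma incl_in_fiber b (e e' : FibOb p b) (x : umap (fe e) (fe e'))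
    (H : lies_over (fe_over e) (fe_over e') x (vid b)) : incl b @@ in_fiber PB H = x.
Proof. by rewrite /fapp /= flift1. Qed.

Lemma fiber_hom_ext b (e e' : fiber PB p b) (X : V) (u v : Hom X (vhom e e')) :
  fmap (incl b) e e' ∘ u = fmap (incl b) e e' ∘ v ->
  fmap (pt b) e e' ∘ u = fmap (pt b) e e' ∘ v -> u = v.
Proof. exact: fib_ext. Qed.

Lemma fiber_map_ext b (e e' : fiber PB p b) (x y : umap e e') :
  vertical x -> vertical y -> incl b @@ x = incl b @@ y -> x = y.
Proof. by move=> vx vy E; apply: fib_ext => //; exact: (etrans vx (esym vy)). Qed.

(** The universal property of [χ(f,e)] inside the fiber: the image in the base of a
    vertical map is fixed, so only the composite with [χ(f,e)] matters. *)
Lemma push_map_ext b c (f : umap b c) (e : fiber PB p b) (d : fiber PB p c)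
    (x y : umap (transport PB p f e) d) :
  vertical x -> vertical y ->
  (incl c @@ x : umap (fe (fpush f e)) (fe d)) ⊚ fchi f e = (incl c @@ y) ⊚ fchi f e -> x = y.
Proof.
move=> vx vy E; apply: fpush_ext; first exact: (etrans vx (esym vy)).
by move: E; rewrite -!precomp_app.
Qed.

(** The equation defining the transport on hom-objects says that [χ(f,-)] is a V-natural
    transformation from the inclusion of the fiber to that of its transport. *)
Lemma chi_natural b c (f : umap b c) :
  is_vnat (F := incl b) (G := fcomp (incl c) (transport PB p f)) (fchi f).
Proof. by move=> x y; rewrite /= transport_chi. Qed.

Lemma transport_map b c (f : umap b c) (e e' : fiber PB p b) (x : umap e e') :
  (incl c @@ transport PB p f @@ x : umap (fe (fpush f e)) (fe (fpush f e'))) ⊚ fchi f e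
  = fchi f e' ⊚ (incl b @@ x).
Proof. by rewrite (vnatu (chi_natural f) x) fapp_fcomp. Qed.

(** Two morphisms into the hom-object from [f_!(D x)] to [K y] agree when they do after
    composing with [χ(f, D x)] and after [pt]; by the naturality of [χ(f,-)], the first
    condition becomes the naturality of the composite family. *)
Lemma push_natural b c (f : umap b c) (C : VCategory V)
    (D : VFunctor C (fiber PB p b)) (K : VFunctor C (fiber PB p c))
    (t : forall x, umap (transport PB p f (D x)) (K x)) :
  (forall x, vertical (t x)) ->
  (forall x y, fmap (pt c) (K x) (K y) ∘ fmap K x y = fmap (pt b) (D x) (D y) ∘ fmap D x y) ->
  is_vnat (F := fcomp (incl b) D) (G := fcomp (incl c) K)
    (fun x => (incl c @@ t x : umap (fe (fpush f (D x))) (fe (K x))) ⊚ fchi f (D x)) ->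
  is_vnat (F := fcomp (transport PB p f) D) (G := K) t.
Proof.
move=> vt ptK natt x y; apply: (fpush_ext (PB := PB)).
- change (fmap (pt c) (transport PB p f (D x)) (K y)
    ∘ (postcomp (transport PB p f (D x)) (t y) ∘ fmap (fcomp (transport PB p f) D) x y)
    = fmap (pt c) (transport PB p f (D x)) (K y) ∘ (precomp (K y) (t x) ∘ fmap K x y)).
  rewrite comp_assoc fmap_postcomp (comp_assoc (fmap (pt c) _ _)) fmap_precomp.
  rewrite (vt x) (vt y) postcomp_id precomp_id !comp_idl ptK /= comp_assoc.
  by rewrite transport_pt.
- change (precomp (fe (K y)) (fchi f (D x)) ∘ (fmap (incl c) (transport PB p f (D x)) (K y)
    ∘ (postcomp (transport PB p f (D x)) (t y) ∘ fmap (fcomp (transport PB p f) D) x y))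
    = precomp (fe (K y)) (fchi f (D x)) ∘ (fmap (incl c) (transport PB p f (D x)) (K y)
     ∘ (precomp (K y) (t x) ∘ fmap K x y))).
  have E := natt x y; rewrite postcomp_comp precomp_comp in E.
  rewrite (comp_assoc (fmap (incl c) _ _)) fmap_postcomp.
  rewrite (comp_assoc (fmap (incl c) _ _) (precomp _ _)) fmap_precomp.
  move: E; asr => E; apply: etrans E.
  rewrite (comp_assoc (precomp _ _)) pre_postcomp; asr; congr (_ ∘ _).
  rewrite /=; asl; congr (_ ∘ _); asr; exact: transport_chi.
Qed.

(** The case where [D] is the identity of the fiber, stated apart because
    [fcomp (transport PB p f) (fid _)] and [transport PB p f] are not convertible. *)
Lemma push_natural_fiber b c (f : umap b c) (K : VFunctor (fiber PB p b) (fiber PB p c))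
    (t : forall x, umap (transport PB p f x) (K x)) :
  (forall x, vertical (t x)) ->
  (forall x y, fmap (pt c) (K x) (K y) ∘ fmap K x y = fmap (pt b) x y) ->
  is_vnat (F := incl b) (G := fcomp (incl c) K)
    (fun x => (incl c @@ t x : umap (fe (fpush f x)) (fe (K x))) ⊚ fchi f x) ->
  is_vnat (F := transport PB p f) (G := K) t.
Proof.
move=> vt ptK natt x y.
have := @push_natural _ _ f _ (fid (fiber PB p b)) K t vt.
rewrite /is_vnat /= => /(_ _ _ x y); rewrite comp_idr; apply=> x' y'.
- by rewrite comp_idr ptK.
- by rewrite comp_idr; exact: natt.
Qed.

(** * Opcartesian maps and the comparison maps [ε] *)

Lemma opcart_id (e : tot p) : opcartesian (proj p) (vid e).
Proof.
move=> d; rewrite fapp_id !precomp_id; split; first by rewrite comp_idr comp_idl.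
move=> Q q1 q2; rewrite comp_idl => E; exists q1.
by split=> [|u [<- _]]; rewrite !comp_idl.
Qed.

(** Pasting of pullback squares. *)
Lemma opcart_comp (e e' e'' : tot p) (y : umap e' e'') (x : umap e e') :
  opcartesian (proj p) y -> opcartesian (proj p) x -> opcartesian (proj p) (y ⊚ x).
Proof.
move=> Hy Hx d; rewrite fmap_ucomp !precomp_comp; split.
  by rewrite comp_assoc (pb_comm (Hx d)) -comp_assoc (pb_comm (Hy d)) comp_assoc.
move=> Q q1 q2; rewrite -comp_assoc => E.
have [u [[u1 u2] uu]] := pb_univ (Hx d) E.
have [v [[v1 v2] vu]] := pb_univ (Hy d) u2.
exists v; split; first by rewrite -comp_assoc v1.
move=> v' [v1' v2']; apply: vu; split=> //; symmetry; apply: uu; split.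
- by rewrite comp_assoc.
- by rewrite comp_assoc (pb_comm (Hy d)) -comp_assoc v2'.
Qed.

Lemma over_ext b c (f : umap b c) (e : FibOb p b) (e' d : FibOb p c)
    (x : umap (fe e) (fe e')) (y z : umap (fe e') (fe d)) (g : umap c c) :
  opcartesian (proj p) x -> lies_over (fe_over e) (fe_over e') x f ->
  lies_over (fe_over e') (fe_over d) y g -> lies_over (fe_over e') (fe_over d) z g ->
  y ⊚ x = z ⊚ x -> y = z.
Proof.
move=> Hx /toB_lies_over xf /toB_lies_over yg /toB_lies_over zg E.
apply: (pb_ext (Hx d)); first by rewrite !precomp_app.
apply: (vcast_mono (p := fe_over e') (q := fe_over d)).
by rewrite !comp_assoc -/(toB e' d) yg zg.
Qed.

(** The inverse of [ε_x] is the factorization of [χ(f,e)] through [x]; both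
    composites lie over the identity and fix an opcartesian map. *)
Lemma eps_iso b c (f : umap b c) (e : FibOb p b) (e' : FibOb p c)
    (x : umap (fe e) (fe e')) (H : lies_over (fe_over e) (fe_over e') x f) :
  opcartesian (proj p) x -> is_viso (in_fiber PB (eps_over H)).
Proof.
move=> Hx.
have [|y [[y1 y2] _]] := opcart_univ (d := fpush f e) (u := fchi f e) (v := vid c)
    Hx (proj1 (toB_lies_over _ _) H).
  by rewrite precomp_app ucomp_idl (proj1 (toB_lies_over _ _) (fchi_over f e)).
have oy := proj2 (toB_lies_over y (vid c)) y2.
have ox := eps_over H.
apply/visoP; exists (in_fiber PB oy); split.
- apply: fiber_map_ext; try (apply: vertical_comp; exact: vertical_in_fiber);
    try exact: vertical_id.
  rewrite fmap_ucomp !incl_in_fiber fapp_id.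
  apply: (over_ext (@fchi_cart _ _ _ _ _ f e) (fchi_over f e) (lies_over_comp oy ox)).
    by rewrite ucomp_idl; exact: lies_over_id.
  by rewrite -ucompA eps_chi ucomp_idl -precomp_app.
- apply: fiber_map_ext; try (apply: vertical_comp; exact: vertical_in_fiber);
    try exact: vertical_id.
  rewrite fmap_ucomp !incl_in_fiber fapp_id.
  apply: (over_ext Hx H (lies_over_comp ox oy)).
    by rewrite ucomp_idl; exact: lies_over_id.
  by move: y1; rewrite precomp_app -ucompA ucomp_idl => ->; rewrite eps_chi.
Qed.

(** * The pseudofunctor of an opfibration *)

(** The equalities [u'] and [w'] are parameters rather than images of [u] and [w], so
    that they can be reflexivity when the underlying objects coincide by computation. *)
Lemma incl_cast b (e e' d d' : fiber PB p b) (u : e = d) (w : e' = d') (x : umap e e')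
    (u' : fe e = fe d) (w' : fe e' = fe d') :
  incl b @@ (vcast u w ∘ x : umap d d') = vcast u' w' ∘ (incl b @@ x).
Proof. by subst; rewrite !vcast1. Qed.

Lemma vertical_idto b (e e' : fiber PB p b) (u : e = e') : vertical (idto u).
Proof. by subst; rewrite /idto vcast1; exact: vertical_id. Qed.

Lemma idto_chi b c (f f' : umap b c) (E : f = f') (e : fiber PB p b)
    (u : transport PB p f e = transport PB p f' e) :
  (incl c @@ idto u : umap (fe (fpush f e)) (fe (fpush f' e))) ⊚ fchi f e = fchi f' e.
Proof. by subst f'; rewrite /idto vcast1 fapp_id ucomp_idl. Qed.

(** For equal [f] and [f'], the identification of [f_!e] with [f'_!e] carries [χ(f,e)]
    to [χ(f',e)]. *)
Lemma cast_chi b c (f f' : umap b c) (E : f = f') (e : fiber PB p b) (d : fiber PB p c)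
    (u : transport PB p f e = transport PB p f' e) (x : umap (transport PB p f e) d) :
  (incl c @@ (vcast u eq_refl ∘ x) : umap (fe (fpush f' e)) (fe d)) ⊚ fchi f' e
  = (incl c @@ x : umap (fe (fpush f e)) (fe d)) ⊚ fchi f e.
Proof. by subst f'; rewrite vcast1. Qed.

Lemma in_fiber_eps_chi b c (f : umap b c) (e : FibOb p b) (e' : FibOb p c)
    (x : umap (fe e) (fe e')) (H : lies_over (fe_over e) (fe_over e') x f) :
  (incl c @@ in_fiber PB (eps_over H)) ⊚ fchi f e = x.
Proof. by rewrite incl_in_fiber eps_chi. Qed.

(** The families [xi] and [theta] are the structure isomorphisms of the pseudofunctor,
    with their endpoints written as values of the transport V-functors. *)
Definition xi b (e : fiber PB p b) : umap (transport PB p (vid b) e) e :=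
  in_fiber PB (eps_over (lies_over_vid e)).

Definition theta b c d (f : umap b c) (g : umap c d) (e : fiber PB p b) :
    umap (transport PB p (g ⊚ f) e) (transport PB p g (transport PB p f e)) :=
  in_fiber PB (eps_over (fchi_comp_over f g e)).

Lemma xi_chi b (e : fiber PB p b) : (incl b @@ xi e) ⊚ fchi (vid b) e = vid (fe e).
Proof. exact: in_fiber_eps_chi. Qed.

Lemma theta_chi b c d (f : umap b c) (g : umap c d) (e : fiber PB p b) :
  (incl d @@ theta f g e) ⊚ fchi (g ⊚ f) e = fchi g (fpush f e) ⊚ fchi f e.
Proof. exact: in_fiber_eps_chi. Qed.

Lemma vertical_xi b (e : fiber PB p b) : vertical (xi e).
Proof. exact: vertical_in_fiber. Qed.

Lemma vertical_theta b c d (f : umap b c) (g : umap c d) (e : fiber PB p b) :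
  vertical (theta f g e).
Proof. exact: vertical_in_fiber. Qed.

Lemma xi_natural b : is_vnat (F := transport PB p (vid b)) (G := fid (fiber PB p b)) (@xi b).
Proof.
apply: push_natural_fiber => [x|x y|x y]; first exact: vertical_xi.
  by rewrite /= comp_idr.
by rewrite /= !xi_chi postcomp_id precomp_id comp_idr.
Qed.

Lemma theta_natural b c d (f : umap b c) (g : umap c d) :
  is_vnat (F := transport PB p (g ⊚ f))
    (G := fcomp (transport PB p g) (transport PB p f)) (theta f g).
Proof.
apply: push_natural_fiber => [x|x y|x y]; first exact: vertical_theta.
  by rewrite /= comp_assoc !transport_pt.
have N := vnat_comp (vnat_whiskerr (transport PB p f) (chi_natural g)) (chi_natural f).
by rewrite !theta_chi; apply: (etrans (N x y)); rewrite /=; asr.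
Qed.

Lemma transport_unitl b c (f : umap b c) (x : fiber PB p b) :
  (transport PB p f @@ xi x) ⊚ theta (vid b) f x
  = idto (f_equal (fun h => transport PB p h x) (ucomp_idr f)).
Proof.
apply: push_map_ext.
- apply: vertical_comp; last exact: vertical_theta.
  by apply: vertical_transport; exact: vertical_xi.
- exact: vertical_idto.
- rewrite (idto_chi (ucomp_idr f)) fmap_ucomp -ucompA theta_chi ucompA.
  by rewrite transport_map -ucompA xi_chi ucomp_idr.
Qed.

Lemma transport_unitr b c (f : umap b c) (x : fiber PB p b) :
  xi (transport PB p f x) ⊚ theta f (vid c) x
  = idto (f_equal (fun h => transport PB p h x) (ucomp_idl f)).
Proof.
apply: push_map_ext.
- by apply: vertical_comp; [exact: vertical_xi|exact: vertical_theta].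
- exact: vertical_idto.
- rewrite (idto_chi (ucomp_idl f)) fmap_ucomp -ucompA theta_chi ucompA.
  by rewrite xi_chi ucomp_idl.
Qed.

Lemma transport_assoc a b c d (f : umap a b) (g : umap b c) (h : umap c d)
    (x : fiber PB p a) :
  vcast (f_equal (fun k => transport PB p k x) (ucompA h g f)) eq_refl
    ∘ ((transport PB p h @@ theta f g x) ⊚ theta (g ⊚ f) h x)
  = theta g h (transport PB p f x) ⊚ theta f (h ⊚ g) x.
Proof.
apply: push_map_ext.
- apply: vertical_cast; apply: vertical_comp; last exact: vertical_theta.
  by apply: vertical_transport; exact: vertical_theta.
- by apply: vertical_comp; exact: vertical_theta.
- rewrite (cast_chi (ucompA h g f)) (fmap_ucomp (incl d)) (fmap_ucomp (incl d)).
  rewrite -[LHS]ucompA -[RHS]ucompA !theta_chi [LHS]ucompA [RHS]ucompA.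
  by rewrite transport_map theta_chi -[LHS]ucompA theta_chi [LHS]ucompA.
Qed.

Definition fiber_pseudofunctor : Pseudofunctor V (underlying B).
Proof.
refine {| psdata := inverse_grothendieck PB p |}.
- exact: xi_natural.
- by move=> b x; apply: eps_iso; exact: opcart_id.
- exact: theta_natural.
- by move=> b c d f g x; apply: eps_iso; apply: opcart_comp; exact: fchi_cart.
- exact: transport_unitl.
- exact: transport_unitr.
- exact: transport_assoc.
Defined.

End Fibers.

(** * Opfibered functors on fibers *)

Section Functors.
Context {V : MonoidalCategory} (PB : Pullbacks V) {B : VCategory V}.
Implicit Types p q r : Opfibration B.
Implicit Types b c d : B.

Lemma FibOb_eq p b (e d : FibOb p b) : fe e = fe d -> e = d.
Proof.
case: e d => [e u] [d w] /= E; subst d; congr Build_FibOb; exact: proof_irrelevance.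
Qed.

(** [incl] and [pt] are jointly faithful, and [incl] is injective on objects. *)
Lemma fiber_functor_ext p b (C : VCategory V) (F G : VFunctor C (fiber PB p b)) :
  fcomp (incl PB p b) F = fcomp (incl PB p b) G ->
  (forall x y, fpt PB (F x) (F y) ∘ fmap F x y = fpt PB (G x) (G y) ∘ fmap G x y) ->
  F = G.
Proof.
move=> E Ept.
have Eob x : F x = G x by apply: FibOb_eq; exact: (f_equal (fun H : VFunctor _ _ => H x) E).
apply: (VFunctor_eq (H := Eob)) => x y; apply: fib_ext.
- have := fmap_eq E (f_equal (incl PB p b) (Eob x)) (f_equal (incl PB p b) (Eob y)).
  by rewrite /= comp_assoc -(fmap_vcast (incl PB p b) (Eob x) (Eob y)) -comp_assoc.
- rewrite -Ept comp_assoc; congr (_ ∘ _).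
  by apply: (etrans (fmap_vcast (pt PB p b) (Eob x) (Eob y))); exact: vcast1.
Qed.

Definition fiber_functor_ob p q (k : OpfibFunctor p q) b (e : FibOb p b) : FibOb q b :=
  {| fe := k (fe e); fe_over := eq_trans (over_ob k (fe e)) (fe_over e) |}.

Lemma toB_fiber_functor_ob p q (k : OpfibFunctor p q) b c (e : FibOb p b) (e' : FibOb p c) :
  toB (fiber_functor_ob k e) (fiber_functor_ob k e') ∘ fmap k (fe e) (fe e') = toB e e'.
Proof.
rewrite /toB -(fmap_eq (ofun_over k) (over_ob k (fe e)) (over_ob k (fe e'))) /=.
by asl; rewrite (vcast_trans _ _ _ _ (fe_over (fiber_functor_ob k e))
  (fe_over (fiber_functor_ob k e'))).
Qed.

Lemma fiber_functorP p q (k : OpfibFunctor p q) b (e e' : FibOb p b) :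
  toB (fiber_functor_ob k e) (fiber_functor_ob k e') ∘ (fmap k (fe e) (fe e') ∘ fincl PB e e')
  = vid b ∘ fpt PB e e'.
Proof. by rewrite comp_assoc toB_fiber_functor_ob fib_comm. Qed.

Definition fiber_functor p q (k : OpfibFunctor p q) b :
  VFunctor (fiber PB p b) (fiber PB q b).
Proof.
refine (@Build_VFunctor _ (fiber PB p b) (fiber PB q b) (fun e => fiber_functor_ob k e)
  (fun e e' => flift PB (fiber_functorP k e e')) _ _).
- move=> e; apply: fib_ext; rewrite !comp_assoc.
  + by rewrite flift1 -comp_assoc /= !flift1 fmap_id.
  + by rewrite flift2 /= !flift2.
- move=> e e' e''; apply: fib_ext; rewrite !comp_assoc.
  + rewrite /= !flift1 -comp_assoc flift1 comp_assoc fmap_comp -!comp_assoc.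
    by rewrite -!tens_comp !flift1.
  + by rewrite /= !flift2 -comp_assoc -tens_comp !flift2.
Defined.

Lemma incl_fiber_functor p q (k : OpfibFunctor p q) b :
  fcomp (incl PB q b) (fiber_functor k b) = fcomp k (incl PB p b).
Proof.
unshelve eapply VFunctor_eq; [by []|move=> x y].
by rewrite vcast1 /= flift1.
Qed.

Lemma fiber_functor_map p q (k : OpfibFunctor p q) b (e e' : fiber PB p b) (x : umap e e') :
  incl PB q b @@ fiber_functor k b @@ x = k @@ incl PB p b @@ x.
Proof. by rewrite /fapp /= !comp_assoc flift1. Qed.

Lemma vertical_fiber_functor p q (k : OpfibFunctor p q) b (e e' : fiber PB p b)
    (x : umap e e') : vertical x -> vertical (fiber_functor k b @@ x).
Proof. by rewrite /vertical /fapp /= comp_assoc flift2. Qed.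

Lemma chi_ofun_over p q (k : OpfibFunctor p q) b c (f : umap b c) (e : FibOb p b) :
  lies_over (fe_over (fiber_functor_ob k e)) (fe_over (fiber_functor_ob k (fpush f e)))
    (k @@ fchi f e) f.
Proof. exact: (lies_over_ofun _ _ (fchi_over f e)). Qed.

(** The pseudonaturality 2-cell of [k] at [f]: [k χ(f,e)] is again an opcartesian lift
    of [f], and this is its comparison with the chosen one. *)
Definition alpha p q (k : OpfibFunctor p q) b c (f : umap b c) (e : fiber PB p b) :
    umap (transport PB q f (fiber_functor k b e)) (fiber_functor k c (transport PB p f e)) :=
  in_fiber PB (eps_over (chi_ofun_over k f e)).

Lemma alpha_chi p q (k : OpfibFunctor p q) b c (f : umap b c) (e : fiber PB p b) :
  (incl PB q c @@ alpha k f e) ⊚ fchi f (fiber_functor_ob k e) = k @@ fchi f e.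
Proof. exact: in_fiber_eps_chi. Qed.

Lemma vertical_alpha p q (k : OpfibFunctor p q) b c (f : umap b c) (e : fiber PB p b) :
  vertical (alpha k f e).
Proof. exact: vertical_in_fiber. Qed.

Lemma alpha_natural p q (k : OpfibFunctor p q) b c (f : umap b c) :
  is_vnat (F := fcomp (transport PB q f) (fiber_functor k b))
    (G := fcomp (fiber_functor k c) (transport PB p f)) (alpha k f).
Proof.
apply: push_natural => [x|x y|x y]; first exact: vertical_alpha.
  by rewrite /= comp_assoc !flift2 transport_pt.
have N := vnat_whiskerl k (chi_natural (PB := PB) (p := p) f) x y.
rewrite !alpha_chi /= flift1; apply: (etrans N).
by rewrite /= (comp_assoc (fincl _ _ _)) flift1; asr.
Qed.

Lemma alpha_comp p q (k : OpfibFunctor p q) b c d (f : umap b c) (g : umap c d)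
    (x : fiber PB p b) :
  (fiber_functor k d @@ theta f g x) ⊚ alpha k (g ⊚ f) x
  = alpha k g (transport PB p f x) ⊚ (transport PB q g @@ alpha k f x)
    ⊚ theta f g (fiber_functor k b x).
Proof.
apply: push_map_ext.
- apply: vertical_comp; last exact: vertical_alpha.
  by apply: vertical_fiber_functor; exact: vertical_theta.
- apply: vertical_comp; last exact: vertical_theta.
  apply: vertical_comp; first exact: vertical_alpha.
  by apply: vertical_transport; exact: vertical_alpha.
- rewrite (fmap_ucomp (incl PB q d)) -[LHS]ucompA alpha_chi fiber_functor_map -fmap_ucomp.
  rewrite theta_chi [LHS]fmap_ucomp !(fmap_ucomp (incl PB q d)) -[RHS]ucompA theta_chi.
  rewrite [RHS]ucompA -(ucompA (incl PB q d @@ alpha k g _)) transport_map.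
  by rewrite (ucompA (incl PB q d @@ alpha k g _)) alpha_chi -[RHS]ucompA alpha_chi.
Qed.

Lemma alpha_id p q (k : OpfibFunctor p q) b (x : fiber PB p b) :
  (fiber_functor k b @@ xi x) ⊚ alpha k (vid b) x = xi (fiber_functor k b x).
Proof.
apply: push_map_ext.
- apply: vertical_comp; last exact: vertical_alpha.
  by apply: vertical_fiber_functor; exact: vertical_xi.
- exact: vertical_xi.
- rewrite (fmap_ucomp (incl PB q b)) -ucompA alpha_chi fiber_functor_map -fmap_ucomp.
  by rewrite !xi_chi fapp_id.
Qed.

Definition opfib_pseudonat p q (k : OpfibFunctor p q) :
  PseudoNat (fiber_pseudofunctor PB p) (fiber_pseudofunctor PB q).
Proof.
refine (@Build_PseudoNat V (underlying B) (fiber_pseudofunctor PB p) (fiber_pseudofunctor PB q)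
  (fiber_functor k) (fun b c f => Build_VNat (alpha_natural k f)) _ _ _).
- by move=> b c f x; apply: eps_iso; apply: ofun_cart; exact: fchi_cart.
- exact: alpha_comp.
- exact: alpha_id.
Defined.

Lemma onat_fiber_over p q (k k' : OpfibFunctor p q) (t : OpfibNat k k') b (e : FibOb p b) :
  lies_over (fe_over (fiber_functor_ob k e)) (fe_over (fiber_functor_ob k' e)) (t (fe e)) (vid b).
Proof.
case: e => e u; subst b; rewrite /lies_over.
exact: onat_over.
Qed.

Definition gamma p q (k k' : OpfibFunctor p q) (t : OpfibNat k k') b (e : fiber PB p b) :
  umap (fiber_functor k b e) (fiber_functor k' b e) := in_fiber PB (onat_fiber_over t e).

Lemma incl_gamma p q (k k' : OpfibFunctor p q) (t : OpfibNat k k') b (e : fiber PB p b) :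
  incl PB q b @@ gamma t e = t (fe e).
Proof. exact: incl_in_fiber. Qed.

Lemma vertical_gamma p q (k k' : OpfibFunctor p q) (t : OpfibNat k k') b (e : fiber PB p b) :
  vertical (gamma t e).
Proof. exact: vertical_in_fiber. Qed.

Lemma gamma_natural p q (k k' : OpfibFunctor p q) (t : OpfibNat k k') b :
  is_vnat (F := fiber_functor k b) (G := fiber_functor k' b) (gamma t (b := b)).
Proof.
move=> x y; apply: fiber_hom_ext; asl.
- rewrite (fmap_postcomp (incl PB q b)) (fmap_precomp (incl PB q b)) !incl_gamma /=.
  by asr; rewrite !flift1; asl; rewrite (natP t).
- rewrite (fmap_postcomp (pt PB q b)) (fmap_precomp (pt PB q b)) !vertical_gamma.
  by rewrite postcomp_id precomp_id !comp_idl /= !flift2.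
Qed.

(** After composing with [χ(f,x)] this is the naturality square of [t] at [χ(f,x)]. *)
Lemma gamma_alpha p q (k k' : OpfibFunctor p q) (t : OpfibNat k k') b c (f : umap b c)
    (x : fiber PB p b) :
  gamma t (transport PB p f x) ⊚ alpha k f x
  = alpha k' f x ⊚ (transport PB q f @@ gamma t x).
Proof.
apply: push_map_ext.
- by apply: vertical_comp; [exact: vertical_gamma|exact: vertical_alpha].
- apply: vertical_comp; first exact: vertical_alpha.
  by apply: vertical_transport; exact: vertical_gamma.
- rewrite !(fmap_ucomp (incl PB q c)) -[LHS]ucompA alpha_chi -[RHS]ucompA transport_map.
  by rewrite [RHS]ucompA alpha_chi !incl_gamma (vnatu (natP t)).
Qed.

Definition opfib_modification p q (k k' : OpfibFunctor p q) (t : OpfibNat k k') :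
  Modification (opfib_pseudonat k) (opfib_pseudonat k').
Proof.
refine (@Build_Modification V (underlying B) _ _ (opfib_pseudonat k) (opfib_pseudonat k')
  (fun b => Build_VNat (gamma_natural t (b := b))) _).
exact: gamma_alpha.
Defined.

(** * Functoriality *)

(** The objects [e] and [e'] may differ in their proofs of lying over [b]; their
    underlying objects are equal by [v], which is reflexivity in the uses below. *)
Lemma cast_push_chi p b c (f : umap b c) (e e' : fiber PB p b) (d d' : fiber PB p c)
    (u : transport PB p f e = transport PB p f e') (w : d = d')
    (x : umap (transport PB p f e) d) (v : fe e = fe e') (v' : fe d = fe d') :
  (incl PB p c @@ (vcast u w ∘ x) : umap (fe (fpush f e')) (fe d')) ⊚ fchi f e'
  = vcast v v' ∘ ((incl PB p c @@ x : umap (fe (fpush f e)) (fe d)) ⊚ fchi f e).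
Proof. by have E := FibOb_eq v; subst e' d'; rewrite !vcast1. Qed.

Lemma fiber_functor_ofid p b : fiber_functor (ofid p) b = fid (fiber PB p b).
Proof.
apply: fiber_functor_ext => [|x y]; last by rewrite /= flift2 comp_idr.
by rewrite incl_fiber_functor fcomp_idl fcomp_idr.
Qed.

Lemma fiber_functor_ofcomp p q r (l : OpfibFunctor q r) (k : OpfibFunctor p q) b :
  fiber_functor (ofcomp l k) b = fcomp (fiber_functor l b) (fiber_functor k b).
Proof.
apply: fiber_functor_ext => [|x y]; last by rewrite /= comp_assoc !flift2.
rewrite incl_fiber_functor fcomp_assoc incl_fiber_functor.
by rewrite -fcomp_assoc incl_fiber_functor fcomp_assoc.
Qed.

Lemma alpha_ofid p b c (f : umap b c) (x : fiber PB p b)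
    (u : transport PB p f (fiber_functor (ofid p) b x) = transport PB p f x)
    (w : fiber_functor (ofid p) c (transport PB p f x) = transport PB p f x) :
  vcast u w ∘ alpha (ofid p) f x = vid (transport PB p f x).
Proof.
apply: push_map_ext.
- by apply: vertical_cast; exact: vertical_alpha.
- exact: vertical_id.
- rewrite fapp_id ucomp_idl (cast_push_chi u w _ (erefl (fe x)) (erefl (fe (fpush f x)))).
  by rewrite vcast1 alpha_chi fapp_fid.
Qed.

Lemma alpha_ofcomp p q r (l : OpfibFunctor q r) (k : OpfibFunctor p q) b c (f : umap b c)
    (x : fiber PB p b)
    (u : transport PB r f (fiber_functor (ofcomp l k) b x)
         = transport PB r f (fiber_functor l b (fiber_functor k b x)))
    (w : fiber_functor (ofcomp l k) c (transport PB p f x)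
         = fiber_functor l c (fiber_functor k c (transport PB p f x))) :
  vcast u w ∘ alpha (ofcomp l k) f x
  = (fiber_functor l c @@ alpha k f x) ⊚ alpha l f (fiber_functor k b x).
Proof.
apply: push_map_ext.
- by apply: vertical_cast; exact: vertical_alpha.
- apply: vertical_comp; last exact: vertical_alpha.
  by apply: vertical_fiber_functor; exact: vertical_alpha.
- rewrite (cast_push_chi u w _ (erefl (l (k (fe x)))) (erefl (l (k (fe (fpush f x)))))).
  rewrite vcast1 alpha_chi (fmap_ucomp (incl PB r c)) -ucompA alpha_chi.
  by rewrite fiber_functor_map -fmap_ucomp alpha_chi fapp_fcomp.
Qed.

Lemma opfib_pseudonat_id p : opfib_pseudonat (ofid p) = pnid (fiber_pseudofunctor PB p).
Proof.
apply: PseudoNat_eq => [b|b c f x u w]; last exact: alpha_ofid.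
exact: fiber_functor_ofid.
Qed.

Lemma opfib_pseudonat_comp p q r (l : OpfibFunctor q r) (k : OpfibFunctor p q) :
  opfib_pseudonat (ofcomp l k) = pncomp (opfib_pseudonat l) (opfib_pseudonat k).
Proof.
apply: PseudoNat_eq => [b|b c f x u w]; last exact: alpha_ofcomp.
exact: fiber_functor_ofcomp.
Qed.

Lemma gamma_onid p q (k : OpfibFunctor p q) b (x : fiber PB p b) :
  gamma (onid k) x = vid (fiber_functor k b x).
Proof.
apply: fiber_map_ext; [exact: vertical_gamma|exact: vertical_id|].
by rewrite incl_gamma fapp_id.
Qed.

Lemma gamma_onvcomp p q (k k' k'' : OpfibFunctor p q)
    (t : OpfibNat k' k'') (s : OpfibNat k k') b (x : fiber PB p b) :
  gamma (onvcomp t s) x = gamma t x ⊚ gamma s x.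
Proof.
apply: fiber_map_ext.
- exact: vertical_gamma.
- by apply: vertical_comp; exact: vertical_gamma.
- by rewrite fmap_ucomp !incl_gamma.
Qed.

Lemma gamma_onhcomp p q r (l l' : OpfibFunctor q r) (k k' : OpfibFunctor p q)
    (t : OpfibNat l l') (s : OpfibNat k k') b (x : fiber PB p b)
    (u : fiber_functor (ofcomp l k) b x = fiber_functor l b (fiber_functor k b x))
    (w : fiber_functor (ofcomp l' k') b x = fiber_functor l' b (fiber_functor k' b x)) :
  vcast u w ∘ gamma (onhcomp t s) x
  = gamma t (fiber_functor k' b x) ⊚ (fiber_functor l b @@ gamma s x).
Proof.
apply: fiber_map_ext.
- by apply: vertical_cast; exact: vertical_gamma.
- apply: vertical_comp; first exact: vertical_gamma.
  by apply: vertical_fiber_functor; exact: vertical_gamma.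
- rewrite (incl_cast u w _ (erefl (l (k (fe x)))) (erefl (l' (k' (fe x))))) vcast1.
  by rewrite fmap_ucomp fiber_functor_map !incl_gamma.
Qed.

Lemma opfib_modification_id p q (k : OpfibFunctor p q) :
  opfib_modification (onid k) = mdid (opfib_pseudonat k).
Proof. by apply: Modification_eq => b x; exact: gamma_onid. Qed.

Lemma opfib_modification_vcomp p q (k k' k'' : OpfibFunctor p q)
    (t : OpfibNat k' k'') (s : OpfibNat k k') :
  opfib_modification (onvcomp t s) = mdvcomp (opfib_modification t) (opfib_modification s).
Proof. by apply: Modification_eq => b x; exact: gamma_onvcomp. Qed.

Lemma opfib_modification_hcomp p q r (l l' : OpfibFunctor q r) (k k' : OpfibFunctor p q)
    (t : OpfibNat l l') (s : OpfibNat k k') :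
  cast2 (@Modification V (underlying B) (fiber_pseudofunctor PB p) (fiber_pseudofunctor PB r))
    (opfib_pseudonat_comp l k) (opfib_pseudonat_comp l' k')
    (opfib_modification (onhcomp t s))
  = mdhcomp (opfib_modification t) (opfib_modification s).
Proof.
by apply: Modification_eq => b x; apply: cast2_modif => u w; exact: gamma_onhcomp.
Qed.

End Functors.

Theorem proposition3p14 (V : MonoidalCategory) (PB : Pullbacks V) (B : VCategory V) :
  exists I : TwoFunctor (opFib B) (FunPs V (underlying B)),
    forall p : Opfibration B, psdata (I p) = inverse_grothendieck PB p.
Proof.
exists (@Build_TwoFunctor (opFib B) (FunPs V (underlying B))
  (fiber_pseudofunctor PB) (fun p q k => opfib_pseudonat PB k)
  (fun p q k k' t => opfib_modification PB t)
  (opfib_pseudonat_id PB)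
  (fun p q r l k => opfib_pseudonat_comp PB l k)
  (fun p q k => opfib_modification_id PB k)
  (fun p q k k' k'' t s => opfib_modification_vcomp PB t s)
  (fun p q r l l' k k' t s => opfib_modification_hcomp PB t s)).
by [].
Qed.
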